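(* Let $\mathfrak i\in\mathcal I$ and $\beta\in\Delta^+$. The following are equivalent: (1) $w_{\mathfrak i}(\alpha_i)=\beta-\delta$ for some $i$ with $0\le i\le n$; (2) $\beta\in\mathcal A_{\mathfrak i}$.
   Context: Setting. $\mathfrak g$ is a complex simple Lie algebra of rank $n$, $\mathfrak b\subset\mathfrak g$ a Borel subalgebra with Cartan component $\mathfrak h$; $\Delta$ is the root system, $\Delta^+$ the positive system determined by $\mathfrak b$, $\Delta^-=-\Delta^+$, $\Pi=\{\alpha_1,\dots,\alpha_n\}$ the simple roots, $\theta$ the highest root. $V=\mathfrak h_{\mathbb R}^*=\bigoplus\mathbb R\alpha_i$ has the inner product $(\ ,\ )$ induced by the Killing form, extended to $V\oplus\mathbb R\delta$ by $(\delta,\delta)=(\delta,V)=0$. $\widehat\Delta=\Delta+\mathbb Z\delta$ is the affine root system, $\widehat\Delta^+=(\Delta^++\mathbb N\delta)\cup(\Delta^-+\mathbb N^+\delta)$ ($0\in\mathbb N$), $\alpha_0=-\theta+\delta$; $\beta<0$ means $-\beta\in\widehat\Delta^+$. $\widehat W$ is the affine Weyl group generated by the reflections $s_\gamma(x)=x-\frac{2(\gamma,x)}{(\gamma,\gamma)}\gamma$, $\gamma\in\{\alpha_0,\dots,\alpha_n\}$, acting on $V\oplus\mathbb R\delta$. $N(w)=\{\beta\in\widehat\Delta^+\mid w^{-1}(\beta)<0\}$. Ideals. $\mathcal I$ is the set of ideals of $\mathfrak b$ contained in $[\mathfrak b,\mathfrak b]$; each is $\mathfrak i=\bigoplus_{\alpha\in\Phi_{\mathfrak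 i}}\mathfrak g_\alpha$ with $\Phi_{\mathfrak i}=\{\beta\in\Delta^+\mid\mathfrak g_\beta\subseteq\mathfrak i\}$. Put $\Phi_{\mathfrak i}^1=\Phi_{\mathfrak i}$, $\Phi_{\mathfrak i}^k=(\Phi_{\mathfrak i}^{k-1}+\Phi_{\mathfrak i})\cap\Delta$ for $k\ge2$, and $L(\mathfrak i)=\bigcup_{k\ge1}(-\Phi_{\mathfrak i}^k+k\delta)$; $w_{\mathfrak i}$ is the unique element of $\widehat W$ with $N(w_{\mathfrak i})=L(\mathfrak i)$. $\mathcal A_{\mathfrak i}$ is the set of minimal elements of $\Phi_{\mathfrak i}$ in the standard partial order ($\alpha\le\beta$ iff $\beta-\alpha$ is a sum of positive roots or zero). *)

(* Defs.v *)
From HB Require Import structures.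
From mathcomp Require Import all_boot all_order all_algebra.
From mathcomp Require Import boolp classical_sets reals complex.

Set Implicit Arguments.
Unset Strict Implicit.
Unset Printing Implicit Defensive.

Import GRing.Theory.
Local Open Scope ring_scope.
Local Open Scope classical_set_scope.

(** * Finite-dimensional Lie algebras *)

HB.mixin Record isLieAlgebra (K : fieldType) L of Vector K L := {
  lie : L -> L -> L;
  lie_linear_l : forall y, linear (lie^~ y);
  lie_linear_r : forall x, linear (lie x);
  lie_alternating : forall x, lie x x = 0;
  lie_jacobi : forall x y z,
    lie x (lie y z) + lie y (lie z x) + lie z (lie x y) = 0
}.

#[short(type="lieAlgType")]
HB.structure Definition LieAlgebra (K : fieldType) :=
  { L of isLieAlgebra K L & Vector K L }.

Definition ad (K : fieldType) (g : lieAlgType K) (x : g) : 'End(g) :=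
  linfun (lie x).

Definition killing (K : fieldType) (g : lieAlgType K) (x y : g) : K :=
  \tr (passmx.mxof (vbasis {:g}) (vbasis {:g}) (ad x \o ad y)%VF).

Definition is_subalgebra (K : fieldType) (g : lieAlgType K) (U : {vspace g}) :=
  forall x y, x \in U -> y \in U -> lie x y \in U.

Definition is_ideal_of (K : fieldType) (g : lieAlgType K)
    (B I : {vspace g}) : Prop :=
  (I <= B)%VS /\ forall x y, x \in B -> y \in I -> lie x y \in I.

Definition simple_lie (K : fieldType) (g : lieAlgType K) : Prop :=
  (exists x y : g, lie x y <> 0) /\
  forall I : {vspace g}, is_ideal_of {:g} I -> I = 0%VS \/ I = {:g}%VS.

(* The span [U, V] of all brackets; by bilinearity, brackets of basis vectors
   are enough. *)
Definition lie_span (K : fieldType) (g : lieAlgType K)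
    (U V : {vspace g}) : {vspace g} :=
  <<[seq lie x y | x <- vbasis U, y <- vbasis V]>>%VS.

Definition solvable_lie (K : fieldType) (g : lieAlgType K)
    (B : {vspace g}) : Prop :=
  exists k, iter k (fun U => lie_span U U) B = 0%VS.

Definition is_borel (K : fieldType) (g : lieAlgType K)
    (b : {vspace g}) : Prop :=
  [/\ is_subalgebra b, solvable_lie b &
      forall b' : {vspace g}, is_subalgebra b' -> solvable_lie b' ->
        (b <= b')%VS -> b' = b].

Definition abelian_lie (K : fieldType) (g : lieAlgType K)
    (U : {vspace g}) : Prop :=
  forall x y, x \in U -> y \in U -> lie x y = 0.

Definition ad_semisimple (K : fieldType) (g : lieAlgType K) (x : g) : Prop :=
  exists2 X : seq g, basis_of {:g} X &
    forall y, y \in X -> exists a : K, lie x y = a *: y.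

(* Cartan subalgebra of a semisimple Lie algebra over an algebraically closed
   field of characteristic 0, in Helgason's definition: a maximal abelian
   subalgebra all of whose elements are ad-semisimple, i.e. ad-diagonalizable.
   An abelian subspace is automatically a subalgebra. *)
Definition is_cartan (K : fieldType) (g : lieAlgType K)
    (h : {vspace g}) : Prop :=
  [/\ abelian_lie h,
      forall h' : {vspace g}, abelian_lie h' -> (h <= h')%VS -> h' = h &
      forall x, x \in h -> ad_semisimple x].

(** * Roots as linear forms on the Cartan subalgebra *)

Definition dual (K : fieldType) (g : lieAlgType K) (h : {vspace g}) :=
  'Hom(subvs_of h, K^o).

Definition root_space (K : fieldType) (g : lieAlgType K) (h : {vspace g})
    (lambda : dual h) : set g :=
  [set x | forall H : subvs_of h, lie (vsval H) x = (lambda H : K) *: x].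

Definition is_root (K : fieldType) (g : lieAlgType K) (h : {vspace g})
    (lambda : dual h) : Prop :=
  lambda <> 0 /\ exists2 x, root_space lambda x & x <> 0.

(* The positive system determined by b: the roots whose root space is in b. *)
Definition is_pos_root (K : fieldType) (g : lieAlgType K) (b h : {vspace g})
    (lambda : dual h) : Prop :=
  is_root lambda /\ root_space lambda `<=` [set` b].

Definition is_simple_root (K : fieldType) (g : lieAlgType K) (b h : {vspace g})
    (lambda : dual h) : Prop :=
  is_pos_root b lambda /\
  ~ exists mu nu : dual h,
      [/\ is_pos_root b mu, is_pos_root b nu & lambda = mu + nu].

Definition enumerates_simple_roots (K : fieldType) (g : lieAlgType K)
    (b h : {vspace g}) (n : nat) (alpha : 'I_n -> dual h) : Prop :=
  injective alpha /\ range alpha = [set lambda | is_simple_root b lambda].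

(* The isomorphism h -> h^* given by the Killing form, and the form it
   transports to h^*: (lambda, mu) = killing t_lambda t_mu, where t_lambda is
   the element of h representing lambda. *)
Definition killing_map (K : fieldType) (g : lieAlgType K) (h : {vspace g})
    : 'Hom(subvs_of h, dual h) :=
  linfun (fun x : subvs_of h =>
    linfun (fun y : subvs_of h => killing (vsval x) (vsval y) : K^o) : dual h).

Definition dual_form (K : fieldType) (g : lieAlgType K) (h : {vspace g})
    (lambda mu : dual h) : K :=
  killing (vsval ((killing_map h)^-1%VF lambda))
          (vsval ((killing_map h)^-1%VF mu)).

(** * The real space V, the affine root system and the affine Weyl group *)

Section AffineRoots.
Context {R : realType} {g : lieAlgType R[i]} (b h : {vspace g}).
Context {n : nat} (alpha : 'I_n -> dual h) (theta : 'rV[R]_n).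

(* V = \bigoplus_i R alpha_i is the space of row vectors of real coordinates in
   the simple roots alpha_i, so that alpha_i itself is [delta_mx 0 i]; V_dual
   is the inclusion of V in h^*. *)
Definition V_dual (v : 'rV[R]_n) : dual h :=
  \sum_(i < n) (v 0 i)%:C%C *: alpha i.

(* The form on h^* takes real values on V. *)
Definition V_form (u v : 'rV[R]_n) : R :=
  complex.Re (dual_form (V_dual u) (V_dual v)).

Definition Delta : set 'rV[R]_n := [set v | is_root (V_dual v)].
Definition Delta_pos : set 'rV[R]_n := [set v | is_pos_root b (V_dual v)].
Definition Delta_neg : set 'rV[R]_n := [set v | Delta_pos (- v)].

Definition root_le (u v : 'rV[R]_n) : Prop :=
  exists2 s : seq 'rV[R]_n,
    (forall x, x \in s -> Delta_pos x) & v - u = \sum_(x <- s) x.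

Definition is_highest_root (v : 'rV[R]_n) : Prop :=
  Delta v /\ forall u, Delta u -> root_le u v.

(* (v, c) stands for v + c delta. *)
Definition Vhat := ('rV[R]_n * R^o)%type.

Definition Vhat_form (x y : Vhat) : R := V_form x.1 y.1.

Definition reflection (x : Vhat) : 'End(Vhat) :=
  linfun (fun y : Vhat => y - (2 * Vhat_form x y / Vhat_form x x) *: x).

(* Index 0 is alpha_0 = - theta + delta and index i + 1 is the simple root
   that [alpha] numbers by i. *)
Definition affine_simple (i : 'I_n.+1) : Vhat :=
  if unlift ord0 i is Some j then (delta_mx 0 j, 0) else (- theta, 1).

Inductive affine_weyl : 'End(Vhat) -> Prop :=
| affine_weyl_id : affine_weyl \1%VF
| affine_weyl_gen i : affine_weyl (reflection (affine_simple i))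
| affine_weyl_mul w1 w2 :
    affine_weyl w1 -> affine_weyl w2 -> affine_weyl (w1 \o w2)%VF
| affine_weyl_inv w : affine_weyl w -> affine_weyl (w^-1)%VF.

Definition Dhat_pos : set Vhat :=
  [set x | (exists k : nat, Delta_pos x.1 /\ x.2 = k%:R) \/
           (exists k : nat, Delta_neg x.1 /\ x.2 = k.+1%:R)].

Definition inversions (w : 'End(Vhat)) : set Vhat :=
  [set x | Dhat_pos x /\ Dhat_pos (- (w^-1)%VF x)].

(** * Ideals of b contained in [b, b] *)

Definition is_nilradical_ideal (I : {vspace g}) : Prop :=
  is_ideal_of b I /\ (I <= lie_span b b)%VS.

Definition Phi (I : {vspace g}) : set 'rV[R]_n :=
  [set v | Delta_pos v /\ root_space (V_dual v) `<=` [set` I]].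

(* Shifted by one: [Phi_pow I k] is Phi_I^{k+1}. *)
Fixpoint Phi_pow (I : {vspace g}) (k : nat) : set 'rV[R]_n :=
  if k is k'.+1 then
    [set w | Delta w /\ exists u v, [/\ Phi_pow I k' u, Phi I v & w = u + v]]
  else Phi I.

Definition L_set (I : {vspace g}) : set Vhat :=
  [set x | exists2 k : nat, Phi_pow I k (- x.1) & x.2 = k.+1%:R].

Definition min_roots (I : {vspace g}) : set 'rV[R]_n :=
  [set v | Phi I v /\ forall u, Phi I u -> root_le u v -> u = v].

End AffineRoots.

(* Main.v *)
Require Import Defs.
From HB Require Import structures.
From mathcomp Require Import all_boot all_order all_algebra.
From mathcomp Require Import boolp classical_sets reals complex.
From mathcomp Require Import ring lra zify.

(** Write [L] for [L(i)], [delta]-coefficients as levels, and call the elements of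
    [Dhat_pos] affine positive roots.

    If [w (alpha_i) = beta - delta], then [- beta + delta] is an inversion of [w],
    so [beta] lies in [Phi]. If [u <= beta] is in [Phi], then [alpha_i] is the sum
    of the affine positive root [- w^-1 (- u + delta)] and of the images under
    [w^-1] of the positive roots whose sum is [beta - u]; these are affine positive
    roots because [L] has no element of level 0. Affine simple roots have height
    1, so that [u = beta] ([simple_to_min]).

    Conversely, let [beta] be minimal and [x = w^-1 (beta - delta)], an affine
    positive root. Some affine simple root [a] satisfies [(x, a) > 0], hence
    [x - a] is a multiple of [delta] or an affine root. The second case is excluded
    by [min_image_indecomposable], which rests on [Phi_pow_sub_min]: if [beta] is
    minimal and [beta + v] is in [Phi^(k+1)] for a positive root [v], then [v] is in
    [Phi^k]. In the first case [x = a], since [w (a)] has level at least [- 1]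
    ([min_to_simple]).

    Both directions need the structure theory of [g], which is obtained from the
    definitions as follows. The Cartan subalgebra being abelian and diagonalizable,
    [g] has a basis of weight vectors. The [sl_2] computation along a root string
    shows that all weights are half-integral multiples of [l H] on [H = [x, y]],
    for [x] and [y] in the root spaces of [l] and [- l]; simplicity then makes the
    Killing form nondegenerate ([killing_nondeg]), which gives [sl_2]-triples,
    lines as root spaces ([root_space_dim1]), [[g_l, g_m] <> 0] when [l + m] is a
    root ([lie_root_neq0]), integrality and reflections ([root_cartan_integer]).
    Finally the roots of [b] form a positive system ([pos_or_neg]): no sum of
    positive roots vanishes, and otherwise a set of roots larger than the positive
    ones, still without vanishing sums, would define a solvable subalgebra larger
    than [b]. *)

Set Implicit Arguments.
Unset Strict Implicit.
Unset Printing Implicit Defensive.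

Import Order.TTheory GRing.Theory Num.Theory passmx.
Local Open Scope ring_scope.

(** * Brackets and the Killing form *)

(** [linfun f] agrees with [f] as soon as [f] is linear as a bare function; it is
    used where [f] carries no canonical linear structure. *)
Lemma linear_linfunE (K : fieldType) (U V : vectType K) (f : U -> V) :
  linear f -> linfun f =1 f.
Proof.
move=> f_lin u.
pose F : {linear U -> V} := HB.pack f (GRing.isLinear.Build _ _ _ _ f f_lin).
exact: (lfunE F).
Qed.

Section LieBasics.
Context {K : fieldType} {g : lieAlgType K}.
Implicit Types x y z : g.

HB.instance Definition _ x :=
  GRing.isLinear.Build K g g *:%R (lie x) (lie_linear_r x).

Lemma lieDl x y z : lie (x + y) z = lie x z + lie y z.
Proof. by have := lie_linear_l z 1 x y; rewrite !scale1r. Qed.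

Lemma lie0l z : lie 0 z = 0.
Proof. by apply: (addIr (lie 0 z)); rewrite -lieDl !add0r. Qed.

Lemma lieZl a x z : lie (a *: x) z = a *: lie x z.
Proof. by have := lie_linear_l z a x 0; rewrite lie0l !addr0. Qed.

Lemma lie_suml (J : Type) (r : seq J) (P : pred J) (F : J -> g) z :
  lie (\sum_(j <- r | P j) F j) z = \sum_(j <- r | P j) lie (F j) z.
Proof.
by apply: (big_morph (lie^~ z)) => [x y|]; rewrite ?lieDl ?lie0l.
Qed.

Lemma lieC x y : lie x y = - lie y x.
Proof.
apply/eqP; rewrite -addr_eq0; apply/eqP.
by have := lie_alternating (x + y); rewrite lieDl !linearD /= !lie_alternating add0r addr0.
Qed.

(** The Jacobi identity: [ad] is a derivation of the bracket. *)
Lemma lie_lie x y z : lie (lie x y) z = lie x (lie y z) - lie y (lie x z).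
Proof.
have := lie_jacobi x y z; rewrite [lie z x]lieC linearN /= [lie z (lie x y)]lieC.
by move/eqP; rewrite subr_eq0 => /eqP.
Qed.

Lemma adE x y : ad x y = lie x y.
Proof. by rewrite lfunE. Qed.

Lemma ad_linear : linear (@ad K g).
Proof.
move=> a x y; apply/lfunP => z.
by rewrite add_lfunE scale_lfunE !adE lieDl lieZl.
Qed.

Lemma ad_lie x y : ad (lie x y) = (ad x \o ad y)%VF - (ad y \o ad x)%VF.
Proof.
apply/lfunP => z; rewrite adE add_lfunE opp_lfunE !comp_lfunE !adE.
exact: lie_lie.
Qed.

Let vb := vbasisP {:g}.

Lemma killingE x y : killing x y =
  \tr (mxof (vbasis {:g}) (vbasis {:g}) (ad y) *m
       mxof (vbasis {:g}) (vbasis {:g}) (ad x)).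
Proof. by rewrite /killing (mxof_comp _ _ vb). Qed.

Lemma killingC x y : killing x y = killing y x.
Proof. by rewrite !killingE mxtrace_mulC. Qed.

Lemma killing_linear_r x : linear (killing x : g -> K^o).
Proof.
move=> a y z; rewrite !killingE ad_linear mxof_linear mulmxDl -scalemxAl.
by rewrite raddfD /= mxtraceZ.
Qed.

HB.instance Definition _ x :=
  GRing.isLinear.Build K g K^o *:%R (killing x : g -> K^o) (killing_linear_r x).

Lemma killingDl x y z : killing (x + y) z = killing x z + killing y z.
Proof. by rewrite ![killing _ z]killingC linearD. Qed.

Lemma killingZl a x z : killing (a *: x) z = a * killing x z.
Proof. by rewrite ![killing _ z]killingC linearZ. Qed.

Lemma killing_inv x y z : killing (lie x y) z = killing x (lie y z).
Proof.
have mxofB (u v : 'End(g)) : mxof (vbasis {:g}) (vbasis {:g}) (u - v) =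
    mxof (vbasis {:g}) (vbasis {:g}) u -
    mxof (vbasis {:g}) (vbasis {:g}) v.
  by rewrite -scaleN1r addrC mxof_linear scaleN1r addrC.
rewrite !killingE !ad_lie !mxofB !(mxof_comp _ _ vb) mulmxBl mulmxBr.
rewrite !linearB /= !mulmxA; congr (_ - _).
by rewrite mxtrace_mulC mulmxA.
Qed.

End LieBasics.

(** * A basis of weight vectors *)

Section WeightBasis.
Context {K : fieldType} {g : lieAlgType K}.

(** The trace of an endomorphism, computed in any basis [f]. *)
Lemma trace_basis (e f : (\dim {:g}).-tuple g) (u : 'End(g)) :
  basis_of {:g} e -> basis_of {:g} f ->
  \tr (mxof e e u) = \sum_i coord f i (u f`_i).
Proof.
move=> be bf.
have -> : \tr (mxof e e u) = \tr (mxof f f u).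
  have uE : u = (\1 \o (u \o \1))%VF by apply/lfunP => x; rewrite !(comp_lfunE, id_lfunE).
  rewrite [in RHS]uE (mxof_comp _ _ be) (mxof_comp _ _ be).
  rewrite mxtrace_mulC mulmxA -(mxof_comp _ _ bf) comp_lfun1r.
  by rewrite mxof1 ?mul1mx // (basis_free be).
by apply: eq_bigr => i _; rewrite !mxE /= vecof_delta.
Qed.

Variable h : {vspace g}.
Hypothesis h_cartan : is_cartan h.

(** The root space decomposition, as a basis [e] of common eigenvectors of the
    Cartan subalgebra: the operators [ad H] commute and are diagonalizable. The
    weight of [e_i] is the linear form [lam i]; roots are the nonzero weights. *)
Lemma weight_basis_exists :
  exists (e : (\dim {:g}).-tuple g) (lam : 'I_(\dim {:g}) -> dual h),
    basis_of {:g} e /\ forall i, root_space (lam i) e`_i.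
Proof.
have [h_ab _ h_ss] := h_cartan.
pose vb := vbasis {:g}; have bvb : basis_of {:g} vb := vbasisP _.
pose M x := mxof vb vb (ad x).
have diagM x : x \in h -> diagonalizable (M x).
  case/h_ss => X bX eX.
  have szX : size X == \dim {:g} by rewrite (size_basis (X := in_tuple X) bX).
  have {}bX : basis_of {:g} (Tuple szX) by [].
  have eigX (i : 'I_(\dim {:g})) : exists a : K, lie x X`_i = a *: X`_i.
    by apply: eX; rewrite mem_nth // (eqP szX).
  have [a aE] := choice eigX; pose Q := mxof (Tuple szX) vb \1.
  have Qu : Q \in unitmx.
    have : Q *m mxof vb (Tuple szX) \1 = 1%:M.
      by rewrite -(mxof_comp _ _ bvb) comp_lfun1r mxof1 // (basis_free bX).
    by case/mulmx1_unit.
  exists Q => //; apply/diagonalizable_forPex; exists (\row_i a i).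
  apply/(simmxP Qu); rewrite -(mxof_comp _ _ bvb) comp_lfun1r.
  apply/row_matrixP => i; rewrite !rowE mulmxA.
  rewrite -[_ *m diag_mx _]rowE row_diag_mx -scalemxAl !mul_mxof.
  by rewrite !vecof_delta id_lfunE adE aE linearZ mxE.
have [P Pu /allP Pd] : codiagonalizable [seq M x | x <- vbasis h].
  apply/codiagonalizableP; split; last first.
    by move=> _ /mapP[x xh ->]; apply: diagM; apply: vbasis_mem.
  move=> _ _ /mapP[x0 xh ->] /mapP[y yh ->].
  rewrite /comm_mx -!(mxof_comp _ _ bvb); congr mxof.
  apply/lfunP => z; rewrite !comp_lfunE !adE; apply/eqP; rewrite eq_sym -subr_eq0.
  by rewrite -lie_lie (h_ab _ _ (vbasis_mem xh) (vbasis_mem yh)) lie0l.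
pose e := [tuple vecof vb (row i P) | i < \dim {:g}].
have eE (i : 'I_(\dim {:g})) : e`_i = vecof vb (row i P) 
  by rewrite (nth_map i) ?size_enum_ord // nth_ord_enum.
have be : basis_of {:g} e.
  rewrite basisEfree subvf size_tuple leqnn !andbT; apply/freeP => k k0 i.
  have : \row_i k i *m P = 0.
    apply/(can_inj (vecofK bvb)); rewrite linear0 -[RHS]k0.
    rewrite mulmx_sum_row linear_sum; apply: eq_bigr => j _.
    by rewrite linearZ /= mxE eE.
  move/(congr1 (mulmx^~ (invmx P))); rewrite mulmxK // mul0mx.
  by move/rowP/(_ i); rewrite !mxE.
have eig (i : 'I_(\dim {:g})) (H : subvs_of h) : exists c : K, lie (vsval H) e`_i = c *: e`_i.
  rewrite (coord_vbasis (subvsP H)) lie_suml.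
  apply: (big_ind (fun x => exists c : K, x = c *: e`_i)).
  - by exists 0; rewrite scale0r.
  - by move=> _ _ [a ->] [b ->]; exists (a + b); rewrite scalerDl.
  move=> j _.
  have xh : (vbasis h)`_j \in vbasis h by rewrite mem_nth // size_tuple.
  have /Pd : M (vbasis h)`_j \in [seq M x | x <- vbasis h] by apply: map_f.
  move=> /= /diagonalizable_forPex[D /(simmxP Pu)/(congr1 (row i))].
  rewrite !row_mul row_diag_mx -scalemxAl mul_mxof -rowE => /(congr1 (vecof vb)).
  rewrite rVofK // adE linearZ /= -eE lieZl => ->.
  by rewrite scalerA; eexists.
exists e, (fun i => linfun (fun H : subvs_of h => coord e i (lie (vsval H) e`_i) : K^o)).
split=> // i H; rewrite linear_linfunE => [|a x y].
  by have [c ->] := eig i H; rewrite linearZ /= (coord_free _ _ (basis_free be)) eqxx mulr1.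
by rewrite linearP /= lieDl lieZl linearP.
Qed.

End WeightBasis.

(** * Weight spaces *)

Section Dual.
Context {K : numFieldType} {g : lieAlgType K} {h : {vspace g}}.
Implicit Types (l m : dual h) (H : subvs_of h) (x y : g).

Lemma dualD l m H : (l + m) H = l H + m H :> K.
Proof. by rewrite add_lfunE. Qed.

Lemma dualN l H : (- l) H = - l H :> K.
Proof. by rewrite opp_lfunE. Qed.

Lemma dual0 H : (0 : dual h) H = 0 :> K.
Proof. by rewrite zero_lfunE. Qed.

Lemma dualMn l k H : (l *+ k) H = l H *+ k :> K.
Proof. by elim: k => [|k IH]; rewrite ?dual0 // !mulrS dualD IH. Qed.

Lemma dualMz l (z : int) H : (l *~ z) H = l H *~ z :> K.
Proof. by case: z => k; rewrite ?NegzE ?mulrNz ?dualN -!pmulrn dualMn. Qed.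

Lemma dual_neq l m : l != m -> exists H, (l H : K) != m H.
Proof.
move=> neq_lm; apply: contrapT => /forallNP eq_lm; case/eqP: neq_lm.
by apply/lfunP => H; apply/eqP/negP => /negP /eq_lm.
Qed.

Lemma dualMn_inj l : l != 0 -> injective (GRing.natmul l).
Proof.
move=> /dual_neq[H]; rewrite dual0 => lH0 j k /(congr1 (fun m : dual h => m H : K)).
by rewrite !dualMn => /(mulrIn lH0).
Qed.

Lemma root_space_lin l x y c :
  root_space l x -> root_space l y -> root_space l (c *: x + y).
Proof. by move=> hx hy H; rewrite linearP /= hx hy scalerDr !scalerA mulrC. Qed.

Lemma root_spaceZ l x c : root_space l x -> root_space l (c *: x).
Proof. by move=> hx H; rewrite linearZ /= hx !scalerA mulrC. Qed.

Lemma lie_root_space l m x y :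
  root_space l x -> root_space m y -> root_space (l + m) (lie x y).
Proof.
move=> hx hy H; have := lie_lie (vsval H) x y; rewrite hx hy lieZl linearZ /= => E.
by rewrite dualD scalerDl E subrK.
Qed.

Lemma iter_lie_root_space l m x v k : root_space l x -> root_space m v ->
  root_space (m + l *+ k) (iter k (lie x) v).
Proof.
move=> hx hv; elim: k => [|k IH]; first by rewrite addr0.
by rewrite mulrS addrCA; apply: lie_root_space.
Qed.

End Dual.

Section Weights.
Context {K : numFieldType} {g : lieAlgType K} {h : {vspace g}}.
Variables (e : (\dim {:g}).-tuple g) (lam : 'I_(\dim {:g}) -> dual h).
Hypotheses (g_simple : simple_lie g) (h_cartan : is_cartan h).
Hypotheses (e_basis : basis_of {:g} e).
Hypotheses (e_weight : forall i, root_space (lam i) e`_i).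
Implicit Types (l m : dual h) (H : subvs_of h) (x y : g).

Lemma eigen_coord x : x = \sum_i coord e i x *: e`_i.
Proof. by apply: (coord_basis e_basis); apply: memvf. Qed.

Lemma coord_eigen (i j : 'I_(\dim {:g})) : coord e i e`_j = (i == j)%:R.
Proof. by rewrite (coord_free _ _ (basis_free e_basis)) eq_sym. Qed.

(** In the basis [e], [ad H] is the diagonal matrix of the [lam i H]. *)
Lemma coord_lie_cartan i H x : coord e i (lie (vsval H) x) = lam i H * coord e i x.
Proof.
rewrite {1}(eigen_coord x) !linear_sum (bigD1 i) //= big1 => [|j ji].
  by rewrite !linearZ /= e_weight linearZ /= coord_eigen eqxx mulr1 addr0 mulrC.
by rewrite !linearZ /= e_weight linearZ /= coord_eigen eq_sym (negPf ji) !mulr0.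
Qed.

Lemma coord_ext x y : (forall i, coord e i x = coord e i y) -> x = y.
Proof.
by move=> E; rewrite (eigen_coord x) (eigen_coord y); apply: eq_bigr => i _; rewrite E.
Qed.

Lemma root_spaceP l x :
  root_space l x <-> forall i, lam i != l -> coord e i x = 0.
Proof.
split=> [hx i /dual_neq[H neq]|hx H].
  have := coord_lie_cartan i H x; rewrite hx linearZ /= => /eqP.
  rewrite -subr_eq0 -mulrBl mulf_eq0 subr_eq0 eq_sym (negPf neq) /=.
  by move/eqP.
apply: coord_ext => i; rewrite coord_lie_cartan linearZ /=.
by have [->//|/hx ->] := eqVneq (lam i) l; rewrite !mulr0.
Qed.

Lemma weight_exists l x : root_space l x -> x != 0 -> exists i, lam i = l.
Proof.
move=> /root_spaceP hx; apply: contra_neqP => /forallNP hl.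
apply: coord_ext => i; rewrite linear0 hx //; exact/eqP.
Qed.

(** The weight space of weight 0 is the Cartan subalgebra: an element commuting
    with [h] spans with [h] an abelian subspace, and [h] is maximal abelian. *)
Lemma root_space0 x : root_space (0 : dual h) x <-> x \in h.
Proof.
have [h_ab h_max _] := h_cartan; split=> [hx|xh H]; last first.
  by rewrite dual0 scale0r h_ab // subvsP.
have hx' y : y \in h -> lie y x = 0.
  by move=> yh; have := hx (Subvs yh); rewrite dual0 scale0r.
have ab : abelian_lie (h + <[x]>)%VS.
  move=> _ _ /memv_addP[y yh [_ /vlineP[c ->] ->]] /memv_addP[z zh [_ /vlineP[d ->] ->]].
  rewrite lieDl !linearD /= (h_ab y z) // !linearZ /= !lieZl hx' // lie_alternating.
  by rewrite [lie x z]lieC hx' ?(linearZ, lie_alternating, oppr0, scaler0, addr0).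
by rewrite -(h_max _ ab (addvSl _ _)) (subvP (addvSr _ _)) ?memv_line.
Qed.

Lemma center0 x : (forall y, lie x y = 0) -> x = 0.
Proof.
move=> xc; have [[y [z /eqP yz]] simp] := g_simple.
case: (simp <[x]>%VS) => [|x0|xf].
- split=> [|a _ _ /vlineP[k ->]]; first exact: subvf.
  by rewrite linearZ /= lieC xc oppr0 scaler0 mem0v.
- by apply/eqP; rewrite -memv0 -x0 memv_line.
have /vlineP[k yE] : y \in <[x]>%VS by rewrite xf memvf.
by move: yz; rewrite yE lieZl xc scaler0 eqxx.
Qed.

(** An element of [h] killed by all weights is central, hence zero. *)
Lemma central_cartan H : (forall i, lam i H = 0 :> K) -> H = 0.
Proof.
move=> H0; apply/val_inj; apply: center0 => y; apply: coord_ext => i.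
by rewrite coord_lie_cartan H0 mul0r linear0.
Qed.

Lemma killing_cartan H H' :
  killing (vsval H) (vsval H') = \sum_i lam i H * lam i H'.
Proof.
rewrite /killing (trace_basis _ (vbasisP _) e_basis); apply: eq_bigr => i _.
rewrite comp_lfunE !adE e_weight linearZ /= e_weight !linearZ /= coord_eigen.
by rewrite eqxx mulr1 mulrC.
Qed.

(** In characteristic 0 the weights [m + k l] are pairwise distinct, and there are
    finitely many weights. *)
Lemma nilpotent_string l m x v : l != 0 -> root_space l x -> root_space m v ->
  exists k, iter k (lie x) v = 0.
Proof.
move=> l0 hx hv; apply: contrapT => /forallNP nz.
have ex (k : 'I_(\dim {:g}).+1) : exists i, lam i = m + l *+ k.
  by apply: weight_exists (iter_lie_root_space k hx hv) _; apply/eqP.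
have [f fE] := choice ex.
suff /leq_card : injective f by rewrite !card_ord ltnn.
move=> j k jk; apply/val_inj/(dualMn_inj l0)/(addrI m).
by rewrite -!fE jk.
Qed.

End Weights.

(** * Root strings and nondegeneracy of the Killing form *)

Section Strings.
Context {K : numFieldType} {g : lieAlgType K} {h : {vspace g}}.
Variables (e : (\dim {:g}).-tuple g) (lam : 'I_(\dim {:g}) -> dual h).
Hypotheses (g_simple : simple_lie g) (h_cartan : is_cartan h).
Hypotheses (e_basis : basis_of {:g} e).
Hypotheses (e_weight : forall i, root_space (lam i) e`_i).
Implicit Types (l m : dual h) (H : subvs_of h) (x y v : g).

(** The [sl_2] computation along the [l]-string below a vector [v] killed by [x];
    no normalization of [l H] is assumed, so that it also covers [l H = 0]. *)
Lemma lie_string l m x y H v k :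
    root_space l x -> root_space (- l) y -> lie x y = vsval H ->
    root_space m v -> lie x v = 0 ->
  lie x (iter k.+1 (lie y) v) =
  (k.+1%:R * (m H - k%:R / 2 * l H)) *: iter k (lie y) v.
Proof.
move=> hx hy xy hv xv0; elim: k => [|k IH].
  have := lie_lie x y v; rewrite xv0 linear0 subr0 /= => <-.
  by rewrite xy hv !mul0r subr0 mul1r.
have E := lie_lie x y (iter k.+1 (lie y) v).
have /eqP := E; rewrite eq_sym subr_eq => /eqP; rewrite [iter k.+2 _ _]iterS => ->.
rewrite xy (iter_lie_root_space k.+1 hy hv) IH linearZ /= -iterS -scalerDl.
congr (_ *: _); rewrite dualD dualMn dualN.
rewrite -[(- _) *+ k.+1]mulr_natr -[k.+2]addn1 -[k.+1]addn1 !natrD.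
by field.
Qed.

Lemma string_bottom l m x y H v :
    l != 0 -> root_space l x -> root_space (- l) y -> lie x y = vsval H ->
    root_space m v -> lie x v = 0 -> v != 0 ->
  exists n, (forall j, (j <= n)%N -> iter j (lie y) v != 0) /\
    2 * m H = n%:R * l H.
Proof.
move=> l0 hx hy xy hv xv0 v0.
have ex : exists k, iter k (lie y) v == 0.
  have [|k /eqP kv] := nilpotent_string e_basis e_weight _ hy hv; last by exists k.
  by rewrite oppr_eq0.
case: (ex_minnP ex) => -[|n] nv0 nmin; first by rewrite (negPf v0) in nv0.
exists n; split=> [j jn|].
  by apply/negP => /nmin; rewrite ltnNge jn.
have := lie_string n hx hy xy hv xv0; rewrite (eqP nv0) linear0 => /esym/eqP.
rewrite scaler_eq0; case/orP => [|/nmin]; last by rewrite ltnn.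
rewrite mulf_eq0 pnatr_eq0 /= subr_eq0 => /eqP ->.
by field.
Qed.

Lemma string_top l m x v :
    l != 0 -> root_space l x -> root_space m v -> v != 0 ->
  exists p, iter p (lie x) v != 0 /\ lie x (iter p (lie x) v) = 0.
Proof.
move=> l0 hx hv v0.
have ex : exists k, iter k (lie x) v == 0.
  by have [k /eqP kv] := nilpotent_string e_basis e_weight l0 hx hv; exists k.
case: (ex_minnP ex) => -[|n] nv0 nmin; first by rewrite (negPf v0) in nv0.
exists n; split; last exact/eqP.
by apply/negP => /nmin; rewrite ltnn.
Qed.

(** Every weight takes on [H = [x, y]] a half-integral multiple of [l H]; in
    particular [l H = 0] makes [H] central. *)
Lemma weight_ratio l m x y H v :
    l != 0 -> root_space l x -> root_space (- l) y -> lie x y = vsval H ->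
    root_space m v -> v != 0 ->
  exists z : int, 2 * m H = z%:~R * l H.
Proof.
move=> l0 hx hy xy hv v0; have [p [t0 xt0]] := string_top l0 hx hv v0.
have [n [_ E]] := string_bottom l0 hx hy xy (iter_lie_root_space p hx hv) xt0 t0.
exists (n%:Z - (2 * p)%:Z); move: E; rewrite dualD dualMn rmorphB /= -!pmulrn natrM.
by rewrite -[_ *+ p]mulr_natr mulrBl => <-; ring.
Qed.

(** The span of the eigenvectors [e_i] for the indices [i] satisfying [Q]. *)
Definition wspace (Q : pred 'I_(\dim {:g})) : {vspace g} :=
  (\sum_(i | Q i) <[e`_i]>)%VS.

Lemma mem_wspace Q x : (x \in wspace Q) <-> forall i, ~~ Q i -> coord e i x = 0.
Proof.
split=> [/memv_sumP[u uQ ->] i Qi|x0].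
  rewrite linear_sum big1 // => j Qj; have /vlineP[c ->] := uQ j Qj.
  rewrite linearZ /= (coord_eigen e_basis).
  have [ij|_] := eqVneq i j; last by rewrite mulr0.
  by move: Qi; rewrite ij Qj.
rewrite (eigen_coord e_basis x) (bigID Q) /= [X in _ + X]big1 => [|i /x0 ->].
  by rewrite addr0; apply: memv_sumr => i _; rewrite memvZ ?memv_line.
by rewrite scale0r.
Qed.

Lemma eigen_wspace (Q : pred _) (i : 'I_(\dim {:g})) : Q i -> e`_i \in wspace Q.
Proof.
move=> Qi; apply/mem_wspace => j Qj; rewrite (coord_eigen e_basis).
by have [ji|//] := eqVneq j i; move: Qj; rewrite ji Qi.
Qed.

Lemma root_space_wspace (Q : pred _) l x :
  root_space l x -> (forall i, lam i = l -> Q i) -> x \in wspace Q.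
Proof.
move=> /(root_spaceP e_basis e_weight) hx hQ; apply/mem_wspace => i Qi.
by apply: hx; apply: contraNneq Qi => /hQ.
Qed.

Lemma wspace_lie (Q Q' : pred _) (V : {vspace g}) x y :
    (forall i j : 'I_(\dim {:g}), Q i -> Q' j -> lie e`_i e`_j \in V) ->
  x \in wspace Q -> y \in wspace Q' -> lie x y \in V.
Proof.
move=> QV /memv_sumP[u uQ ->] /memv_sumP[w wQ ->].
rewrite lie_suml; apply: memv_suml => i Qi; rewrite linear_sum /=.
apply: memv_suml => j Qj; have /vlineP[c ->] := uQ i Qi.
have /vlineP[d ->] := wQ j Qj.
by rewrite lieZl linearZ /= !memvZ // QV.
Qed.

Lemma eigen_neq0 (i : 'I_(\dim {:g})) : e`_i != 0.
Proof.
apply/eqP => ei0; have := coord_eigen e_basis i i.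
by rewrite ei0 linear0 eqxx => /esym/eqP; rewrite oner_eq0.
Qed.

(** Otherwise the span of the root vectors would be an ideal: either it is zero and
    [g = h] is abelian, or it is [g], and then [h = 0] and there are no roots. *)
Lemma root_bracket_neq0 : exists l x y,
  [/\ l != 0, root_space (l : dual h) x, root_space (- l) y & lie x y != 0].
Proof.
have [h_ab _ _] := h_cartan.
have [[a [b /eqP ab]] simp] := g_simple.
apply: contrapT => /forallNP no.
pose Q i := lam i != 0.
have noi (i j : 'I_(\dim {:g})) : Q i -> lam i + lam j = 0 -> lie e`_i e`_j = 0.
  move=> Qi ij; apply/eqP; apply: contrapT => /negP bra.
  apply: (no (lam i)); exists e`_i, e`_j; split=> //.
  have <- : lam j = - lam i by apply/eqP; rewrite -addr_eq0 addrC ij.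
  exact: e_weight.
have idU : is_ideal_of {:g} (wspace Q).
  split=> [|x y _]; first exact: subvf.
  have : x \in wspace predT by apply/mem_wspace.
  apply: wspace_lie => i j _ Qj.
  have [ij|ij] := eqVneq (lam i + lam j) 0.
    by rewrite lieC noi ?oppr0 ?mem0v // addrC.
  apply: (root_space_wspace (lie_root_space (e_weight i) (e_weight j))) => k E.
  by rewrite /Q E.
have [U0|Uf] := simp _ idU.
  have lam0 i : lam i = 0.
    apply/eqP; apply: contraT => Qi; have := eigen_neq0 i.
    by rewrite -memv0 -U0 eigen_wspace.
  have inh x : x \in h.
    apply/(root_space0 h_cartan)/(root_spaceP e_basis e_weight) => i.
    by rewrite lam0 eqxx.
  by move: ab; rewrite h_ab ?eqxx.
have Qi i : Q i.
  apply: contraT => Qi; have : e`_i \in wspace Q by rewrite Uf memvf.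
  move/mem_wspace/(_ i Qi); rewrite (coord_eigen e_basis) eqxx => /eqP.
  by rewrite oner_eq0.
have H0 H : H = 0.
  apply/val_inj/(coord_ext e_basis) => i; rewrite linear0.
  have := subvsP H => /(root_space0 h_cartan)/(root_spaceP e_basis e_weight).
  by apply; apply: Qi.
have /eqP[] : a != 0 by apply: contraNneq ab => ->; rewrite lie0l.
apply: (coord_ext e_basis) => i; have /eqP[] := Qi i.
by apply/lfunP => H; rewrite (H0 H) !linear0.
Qed.

Lemma root_bracket_weight_neq0 l x y H :
    l != 0 -> root_space l x -> root_space (- l) y -> lie x y = vsval H ->
    H != 0 ->
  l H != 0 :> K.
Proof.
move=> l0 hx hy xy; apply: contraNneq => lH0.
apply/eqP; apply: (central_cartan g_simple e_basis e_weight) => i.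
have [z] := weight_ratio l0 hx hy xy (e_weight i) (eigen_neq0 i).
by rewrite lH0 mulr0 => /eqP; rewrite mulf_eq0 pnatr_eq0 /= => /eqP.
Qed.

Lemma lie_opp_root_space l x y : root_space l x -> root_space (- l) y ->
  exists H, lie x y = vsval H.
Proof.
move=> hx hy; have := lie_root_space hx hy; rewrite subrr.
by move/(root_space0 h_cartan) => xyh; exists (Subvs xyh).
Qed.

(** By [weight_ratio] the trace form on [H = [x, y]] is a sum of squares of
    half-integers times [(l H)^2]. *)
Lemma killing_bracket_gt0 l x y H :
    l != 0 -> root_space l x -> root_space (- l) y -> lie x y = vsval H ->
    l H != 0 :> K -> x != 0 ->
  exists2 n : nat, (0 < n)%N &
    4 * killing (vsval H) (vsval H) = n%:R * (l H) ^+ 2.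
Proof.
move=> l0 hx hy xy lH0 x0.
have /choice[z zE] : forall i, exists z : int, 2 * lam i H = z%:~R * l H.
  by move=> i; apply: (weight_ratio l0 hx hy xy (e_weight i) (eigen_neq0 i)).
have [i0 li0] := weight_exists e_basis e_weight hx x0.
have z0 : z i0 != 0.
  apply/eqP => z0; have /eqP := zE i0.
  by rewrite li0 z0 mul0r mulf_eq0 (negPf lH0) pnatr_eq0.
exists (\sum_i `|z i| ^ 2)%N.
  by rewrite (bigD1 i0) //= ltn_addr // expn_gt0 absz_gt0 z0.
rewrite (killing_cartan e_basis e_weight) mulr_sumr natr_sum mulr_suml.
apply: eq_bigr => i _; have -> : 4 = 2 * 2 :> K by rewrite -natrM.
rewrite mulrACA -expr2 zE exprMn natrX; congr (_ * _).
by case: (z i) => k; rewrite ?NegzE /= ?mulrNz ?sqrrN -?pmulrn ?abszN.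
Qed.

(** Cartan's criterion, in the case where a diagonalizable Cartan subalgebra is
    given. *)
Lemma killing_neq0 : exists x y : g, killing x y != 0.
Proof.
have [l [x [y [l0 hx hy xy0]]]] := root_bracket_neq0.
have [H xy] := lie_opp_root_space hx hy.
have lH : l H != 0 :> K.
  apply: (root_bracket_weight_neq0 l0 hx hy xy).
  by apply: contraNneq xy0 => H0; rewrite xy H0.
have x0 : x != 0 by apply: contraNneq xy0 => ->; rewrite lie0l.
have [n n0 E] := killing_bracket_gt0 l0 hx hy xy lH x0.
exists (vsval H), (vsval H); apply: contraTneq n0 => k0; move: E.
rewrite k0 mulr0 => /esym/eqP; rewrite mulf_eq0 expf_eq0 (negPf lH) orbF pnatr_eq0.
by move/eqP->.
Qed.

(** The radical of the Killing form is an ideal of the simple algebra [g]. *)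
Lemma killing_nondeg x : (forall y, killing x y = 0) -> x = 0.
Proof.
pose rad := lker (linfun (fun x => linfun (killing x : g -> K^o))).
have radP z : (z \in rad) <-> forall y, killing z y = 0.
  rewrite memv_ker linear_linfunE => [|c u w].
    split=> [/eqP/lfunP E y|E]; first by have := E y; rewrite lfunE zero_lfunE.
    by apply/eqP/lfunP => y; rewrite lfunE zero_lfunE; apply: E.
  by apply/lfunP => y; rewrite add_lfunE scale_lfunE !lfunE /= killingDl killingZl.
have idr : is_ideal_of {:g} rad.
  split=> [|a b _ /radP b0]; first exact: subvf.
  apply/radP => y; rewrite lieC -scaleN1r killingZl killing_inv b0 mulr0 //.
have [_ /(_ _ idr)[r0|rf]] := g_simple.
  by move=> x0; apply/eqP; rewrite -memv0 -r0; apply/radP.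
have [a [b /eqP[]]] := killing_neq0.
by apply: (radP a).1; rewrite rf memvf.
Qed.

Lemma killing_root_space l m x y :
  root_space l x -> root_space m y -> l + m != 0 -> killing x y = 0.
Proof.
move=> hx hy /dual_neq[H]; rewrite dualD dual0 => lm0.
have := killing_inv x (vsval H) y; rewrite lieC -scaleN1r hx hy !killingZl linearZ /=.
move/eqP; rewrite -subr_eq0 mulN1r -opprD oppr_eq0 -[_ *: _]/(_ * _) -mulrDl.
by rewrite mulf_eq0 (negPf lm0) => /eqP.
Qed.

(** The Killing form remains nondegenerate on [h], which is orthogonal to the root
    vectors. *)
Lemma killing_cartan_nondeg H :
  (forall H', killing (vsval H) (vsval H') = 0) -> H = 0.
Proof.
move=> H0; apply/val_inj/killing_nondeg => y.
rewrite (eigen_coord e_basis y) linear_sum big1 // => i _; rewrite linearZ /=.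
suff -> : killing (vsval H) e`_i = 0 by rewrite scaler0.
have [li0|li0] := eqVneq (lam i) 0.
  have ei : e`_i \in h by apply/(root_space0 h_cartan); rewrite -li0; apply: e_weight.
  exact: (H0 (Subvs ei)).
have hH : root_space (0 : dual h) (vsval H) by apply/(root_space0 h_cartan)/subvsP.
by apply: (killing_root_space hH (e_weight i)); rewrite add0r.
Qed.

Lemma killing_dual_vector l x : root_space l x -> x != 0 ->
  exists2 y, root_space (- l) y & killing x y != 0.
Proof.
move=> hx x0.
have [i ki] : exists i : 'I_(\dim {:g}), killing x e`_i != 0.
  apply: contrapT => /forallNP no; case/eqP: x0; apply: killing_nondeg => y.
  rewrite (eigen_coord e_basis y) linear_sum big1 // => i _; rewrite linearZ /=.
  by have /negP/negPn/eqP -> := no i; rewrite scaler0.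
exists e`_i => //; suff -> : - l = lam i by apply: e_weight.
apply/esym/eqP; rewrite -addr_eq0 addrC; apply: contraTT ki => li.
by rewrite (killing_root_space hx (e_weight i) li) eqxx.
Qed.

(** An [sl_2]-triple [(x, y, H)] attached to the root [l]. *)
Definition sl2_triple l x y H :=
  [/\ root_space l x, root_space (- l) y, lie x y = vsval H & l H = 2 :> K].

Lemma killing_lie_cartan l x y H : root_space l x -> root_space (- l) y ->
  killing (lie x y) (vsval H) = l H * killing x y.
Proof.
move=> hx hy; rewrite killing_inv lieC hy dualN scaleNr opprK linearZ //.
Qed.

Lemma sl2_triple_exists l x : l != 0 -> root_space l x -> x != 0 ->
  exists y H, sl2_triple l x y H.
Proof.
move=> l0 hx x0; have [y hy kxy] := killing_dual_vector hx x0.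
have [H xy] := lie_opp_root_space hx hy.
have H0 : H != 0.
  have [H' lH'] := dual_neq l0; rewrite dual0 in lH'.
  apply: contraNneq (mulf_neq0 lH' kxy) => H0.
  by rewrite -killing_lie_cartan // xy H0 killingC linear0.
have lH := root_bracket_weight_neq0 l0 hx hy xy H0.
exists ((2 / l H) *: y), ((2 / l H) *: H); split=> //.
- exact: root_spaceZ.
- by rewrite linearZ /= xy.
by rewrite linearZ /= -[_ *: _]/(_ * _) divfK.
Qed.

End Strings.

(** * [sl_2]-triples *)

Section SL2.
Context {K : numFieldType} {g : lieAlgType K} {h : {vspace g}}.
Variables (e : (\dim {:g}).-tuple g) (lam : 'I_(\dim {:g}) -> dual h).
Hypotheses (g_simple : simple_lie g) (h_cartan : is_cartan h).
Hypotheses (e_basis : basis_of {:g} e).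
Hypotheses (e_weight : forall i, root_space (lam i) e`_i).
Implicit Types (l m : dual h) (H : subvs_of h) (x y v u : g).

Lemma sl2_triple_neq0 l x y H : sl2_triple l x y H -> l != 0.
Proof.
case=> _ _ _ lH; apply/eqP => l0; move: lH; rewrite l0 dual0 => /eqP.
by rewrite eq_sym pnatr_eq0.
Qed.

Lemma sl2_triple_opp l x y H : sl2_triple l x y H -> sl2_triple (- l) y x (- H).
Proof.
case=> hx hy xy lH; split=> //; rewrite ?opprK //.
  by rewrite lieC xy linearN.
by rewrite dualN linearN /= opprK.
Qed.

Lemma sl2_bottom l m x y H v : sl2_triple l x y H ->
    root_space m v -> lie x v = 0 -> v != 0 ->
  exists n : nat, (forall j, (j <= n)%N -> iter j (lie y) v != 0) /\ m H = n%:R.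
Proof.
move=> xyH hv xv0 v0; have [hx hy xy lH] := xyH; have l0 := sl2_triple_neq0 xyH.
have [n [n0 E]] := string_bottom e_basis e_weight l0 hx hy xy hv xv0 v0.
exists n; split=> //; move: E; rewrite lH mulrC.
by apply: mulIf; rewrite pnatr_eq0.
Qed.

Lemma sl2_int l m x y H v : sl2_triple l x y H -> root_space m v -> v != 0 ->
  exists z : int, m H = z%:~R.
Proof.
move=> xyH hv v0; have [hx hy xy lH] := xyH; have l0 := sl2_triple_neq0 xyH.
have [z E] := weight_ratio e_basis e_weight l0 hx hy xy hv v0.
exists z; move: E; rewrite lH mulrC.
by apply: mulIf; rewrite pnatr_eq0.
Qed.

Lemma sl2_raise l m x y H v : sl2_triple l x y H -> root_space m v -> v != 0 ->
  (m H : K) < 0 -> lie x v != 0.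
Proof.
move=> xyH hv v0; apply: contraTneq => xv0.
by have [n [_ ->]] := sl2_bottom xyH hv xv0 v0; rewrite ltrn0.
Qed.

Lemma sl2_lower l m x y H v : sl2_triple l x y H -> root_space m v -> v != 0 ->
  0 < (m H : K) -> lie y v != 0.
Proof.
move=> /sl2_triple_opp xyH hv v0 mH; apply: (sl2_raise xyH hv v0).
by rewrite linearN /= oppr_lt0.
Qed.

(** The reflection of a weight in a root is a weight. *)
Lemma sl2_reflect l m x y H v (z : int) :
    sl2_triple l x y H -> root_space m v -> v != 0 -> m H = z%:~R ->
  exists2 u, u != 0 & root_space (m - l *~ z) u.
Proof.
wlog z0 : l x y H z / 0 <= z => [IH xyH hv v0 mH|].
  have [z0|z0] := leP 0 z; first exact: (IH l x y H z).
  have [] := IH _ _ _ _ (- z) _ (sl2_triple_opp xyH) hv v0.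
  - by rewrite oppr_ge0 ltW.
  - by rewrite linearN /= mH mulrNz.
  by move=> u u0; rewrite mulrNz mulNrz opprK; exists u.
case: z z0 => // z _ xyH hv v0 mH.
have [hx hy xy lH] := xyH; have l0 := sl2_triple_neq0 xyH.
have [p [t0 xt0]] := string_top e_basis e_weight l0 hx hv v0.
have ht := iter_lie_root_space p hx hv.
have [n [n0 E]] := sl2_bottom xyH ht xt0 t0.
have {E} E : n = (z + 2 * p)%N.
  apply/eqP; rewrite -(eqr_nat K) -E dualD dualMn mH lH natrD natrM.
  by rewrite -[_ *+ p]mulr_natr.
(* The string has its top at [m + p l] and length [z + 2 p]; descending [z + p]
   steps from the top reaches [m - z l]. *)
exists (iter (z + p) (lie y) (iter p (lie x) v)); first by apply: n0; rewrite E; lia.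
have := iter_lie_root_space (z + p) hy ht.
by rewrite mulNrn mulrnDr opprD addrACA subrr addr0.
Qed.

(** Root spaces are lines: a vector [w] of [g_l] orthogonal to [y] satisfies
    [[y, w] = 0], which is impossible for a nonzero vector of positive weight. *)
Lemma root_space_dim1 l x u : l != 0 -> root_space l x -> x != 0 ->
  root_space l u -> exists c, u = c *: x.
Proof.
move=> l0 hx x0 hu.
have [y [H xyH]] := sl2_triple_exists g_simple h_cartan e_basis e_weight l0 hx x0.
have [_ hy xy lH] := xyH.
have kxy : killing x y != 0.
  have : killing (vsval H) (vsval H) != 0.
    have lH0 : l H != 0 :> K by rewrite lH pnatr_eq0.
    have [n n0 E] := killing_bracket_gt0 e_basis e_weight l0 hx hy xy lH0 x0.
    apply: contraTneq n0 => k0; move: E; rewrite k0 mulr0 => /esym/eqP.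
    by rewrite mulf_eq0 expf_eq0 (negPf lH0) orbF pnatr_eq0 => /eqP->.
  by rewrite -{1}xy (killing_lie_cartan _ hx hy); apply: contraNneq => ->; rewrite mulr0.
exists (killing u y / killing x y); apply/eqP; rewrite -subr_eq0.
set w := u - _; have hw : root_space l w.
  by rewrite /w addrC -scaleNr; apply: root_space_lin.
have kwy : killing w y = 0.
  by rewrite /w killingDl -scaleNr killingZl mulNr divfK ?subrr.
apply: contraT => w0; have /negP[] : lie y w != 0.
  by apply: (sl2_lower xyH hw w0); rewrite lH ltr0n.
have [H' yw] := lie_opp_root_space h_cartan hw hy.
rewrite lieC yw oppr_eq0 [H'](killing_cartan_nondeg g_simple h_cartan e_basis e_weight) //.
by move=> H2; rewrite -yw (killing_lie_cartan _ hw hy) kwy mulr0.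
Qed.

(** [[g_l, g_m] <> 0] whenever [l], [m] and [l + m] are roots. If [m H < 0] this is
    [sl2_raise]; otherwise the string is climbed from [g_(l + m)] to its top and
    then descended to the line [g_m]. *)
Lemma lie_root_neq0 l m x u v :
    l != 0 -> m != 0 -> root_space l x -> x != 0 -> root_space m u -> u != 0 ->
    root_space (l + m) v -> v != 0 ->
  lie x u != 0.
Proof.
move=> l0 m0 hx x0 hu u0 hv v0.
have [y [H xyH]] := sl2_triple_exists g_simple h_cartan e_basis e_weight l0 hx x0.
have [_ hy xy lH] := xyH.
have [[z|z] mH] := sl2_int xyH hu u0; last first.
  by apply: (sl2_raise xyH hu u0); rewrite mH ltrz0.
have [p [t0 xt0]] := string_top e_basis e_weight l0 hx hv v0.
have ht := iter_lie_root_space p hx hv.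
have [n [n0 E]] := sl2_bottom xyH ht xt0 t0.
have En : n = (2 + z + 2 * p)%N.
  apply/eqP; rewrite -(eqr_nat K) -E !dualD dualMn mH lH natrD [(2 + z)%:R]natrD natrM.
  by rewrite -[_ *+ p]mulr_natr.
have := lie_string p hx hy xy ht xt0; set u' := iter p.+1 _ _ => xu'.
have u'0 : u' != 0 by apply: n0; rewrite En; lia.
have hu' : root_space m u'.
  have := iter_lie_root_space p.+1 hy ht.
  rewrite mulNrn mulrSr opprD addrA addrK.
  by rewrite [l + m]addrC addrK.
have [c u'E] := root_space_dim1 m0 hu u0 hu'.
have : lie x u' != 0.
  rewrite xu' scaler_eq0 negb_or n0; last by rewrite En; lia.
  rewrite andbT mulf_neq0 ?pnatr_eq0 // E lH divfK ?pnatr_eq0 //.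
  by rewrite subr_eq0 eqr_nat En; apply/eqP; lia.
by rewrite u'E linearZ /= scaler_eq0 negb_or => /andP[].
Qed.

End SL2.

(** * Borel subalgebras: positive roots have no vanishing sum *)

Section Sums.
Context {V : zmodType}.
Implicit Types (P Q : V -> Prop) (u v : V) (s : seq V).

(** [psum P v]: [v] is a sum of a nonempty family of elements of [P]. *)
Inductive psum P : V -> Prop :=
| psum1 u of P u : psum P u
| psumS u v of P u & psum P v : psum P (u + v).

Lemma psumD P u v : psum P u -> psum P v -> psum P (u + v).
Proof.
elim=> [u' Pu' Pv|u' w Pu' _ IH Pv]; first exact: psumS.
by rewrite -addrA; apply: psumS (IH Pv).
Qed.

Lemma psumMn P u k : psum P u -> psum P (u *+ k.+1).
Proof. by move=> Pu; elim: k => // k IH; rewrite mulrS; apply: psumD. Qed.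

Lemma psumP P u : psum P u ->
  exists s, [/\ forall v, v \in s -> P v, s != [::] & u = \sum_(v <- s) v].
Proof.
elim=> [v Pv|v w Pv _ [s [Ps _ ->]]].
  by exists [:: v]; split=> //; [move=> w; rewrite inE => /eqP->|rewrite big_seq1].
exists (v :: s); split=> //; last by rewrite big_cons.
by move=> t; rewrite in_cons => /orP[/eqP->|/Ps].
Qed.

Lemma psumU1 P l v : psum (fun u => P u \/ u = l) v ->
  exists k, v = l *+ k.+1 \/ exists2 u, psum P u & v = u + l *+ k.
Proof.
elim=> [u [Pu|->]|u w Pu _ [k [->|[t Pt ->]]]].
- by exists 0%N; right; exists u; [apply: psum1|rewrite addr0].
- by exists 0%N; left; rewrite mulr1n.
- case: Pu => [Pu|->]; last by exists k.+1; left; rewrite -mulrS.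
  by exists k.+1; right; exists u => //; apply: psum1.
case: Pu => [Pu|->]; first by exists k; right; exists (u + t); rewrite ?addrA //; apply: psumS.
by exists k.+1; right; exists t => //; rewrite mulrS addrCA.
Qed.

(** If no sum of elements of [P] vanishes, then [P] can be enlarged by [l] or by
    [- l] while keeping this property: two relations [u + j l = 0] and
    [v - k l = 0], with [u] and [v] sums of elements of [P], combine into
    [k u + j v = 0]. *)
Lemma psum_extend P l : ~ psum P 0 -> (forall k, l *+ k.+1 != 0) ->
  ~ psum (fun u => P u \/ u = l) 0 \/ ~ psum (fun u => P u \/ u = - l) 0.
Proof.
move=> P0 l0; apply/not_andP => -[/psumU1[k [E|[u Pu E]]] /psumU1[j [F|[v Pv F]]]].
- by case/eqP: (l0 k).
- by case/eqP: (l0 k).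
- by move: F; rewrite mulNrn => /esym/eqP; rewrite oppr_eq0 (negPf (l0 j)).
case: k E => [|k] E; first by move: Pu P0; rewrite E addr0.
case: j F => [|j] F; first by move: Pv P0; rewrite F addr0.
apply: P0; have -> : 0 = u *+ j.+1 + v *+ k.+1.
  have /eqP := E; rewrite eq_sym addr_eq0 => /eqP ->.
  have /eqP := F; rewrite eq_sym addr_eq0 mulNrn opprK => /eqP ->.
  by rewrite mulNrn -!mulrnA mulnC addNr.
by apply: psumD; apply: psumMn.
Qed.

End Sums.

Section LieSpan.
Context {K : fieldType} {g : lieAlgType K}.
Implicit Types (U V W : {vspace g}) (x y : g).

Lemma lie_span_sub U V W :
  (forall x y, x \in U -> y \in V -> lie x y \in W) -> (lie_span U V <= W)%VS.
Proof.
move=> UVW; apply/span_subvP => _ /allpairsP[[x y] /= [xU yV ->]].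
by apply: UVW; apply: vbasis_mem.
Qed.

Lemma mem_lie_span U V x y : x \in U -> y \in V -> lie x y \in lie_span U V.
Proof.
move=> xU yV; rewrite (coord_vbasis xU) (coord_vbasis yV) lie_suml.
apply: memv_suml => i _; rewrite linear_sum; apply: memv_suml => j _ /=.
rewrite lieZl linearZ /= !memvZ //; apply: memv_span; apply: allpairs_f.
  by rewrite mem_nth // size_tuple.
by rewrite mem_nth // size_tuple.
Qed.

End LieSpan.

Section Borel.
Context {K : numFieldType} {g : lieAlgType K} {b h : {vspace g}}.
Variables (e : (\dim {:g}).-tuple g) (lam : 'I_(\dim {:g}) -> dual h).
Hypotheses (g_simple : simple_lie g) (h_cartan : is_cartan h).
Hypotheses (e_basis : basis_of {:g} e).
Hypotheses (e_weight : forall i, root_space (lam i) e`_i).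
Hypotheses (b_borel : is_borel b) (h_sub_b : (h <= b)%VS).
Implicit Types (l m : dual h) (H : subvs_of h) (x y v u : g).

Lemma is_rootP l : is_root l <-> l != 0 /\ exists2 x, root_space l x & x != 0.
Proof.
split=> [[/eqP l0 [x hx /eqP x0]]|[/eqP l0 [x hx /eqP x0]]]; split=> //; by exists x.
Qed.

Lemma is_root_opp l : is_root l -> is_root (- l).
Proof.
case/is_rootP => l0 [x hx x0].
have [y hy kxy] := killing_dual_vector g_simple h_cartan e_basis e_weight hx x0.
apply/is_rootP; rewrite oppr_eq0; split=> //; exists y => //.
by apply: contraNneq kxy => ->; rewrite linear0.
Qed.

Lemma pos_root_mem l x : l != 0 -> root_space l x -> x != 0 -> x \in b ->
  is_pos_root b l.
Proof.
move=> l0 hx x0 xb; split; first by apply/is_rootP; split=> //; exists x.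
move=> u hu /=.
have [c ->] := root_space_dim1 g_simple h_cartan e_basis e_weight l0 hx x0 hu.
exact: memvZ.
Qed.

(** A solvable algebra contains no [sl_2]-triple. *)
Lemma pos_root_opp l : is_pos_root b l -> ~ is_pos_root b (- l).
Proof.
move=> [/is_rootP[l0 [x hx x0]] lb] [_ nlb].
have [y [H [_ hy xy lH]]] :=
  sl2_triple_exists g_simple h_cartan e_basis e_weight l0 hx x0.
have [_ [k bk0] _] := b_borel.
suff : [/\ x \in iter k (fun U => lie_span U U) b, y \in iter k (fun U => lie_span U U) b
          & vsval H \in iter k (fun U => lie_span U U) b].
  by case=> + _ _; rewrite bk0 memv0 (negPf x0).
elim: k {bk0} => [|k [xk yk Hk]] /=.
  by split; [exact: lb|exact: nlb|exact: (subvP h_sub_b) (subvsP H)].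
have two0 : (2 : K) != 0 by rewrite pnatr_eq0.
split; last by rewrite -xy mem_lie_span.
  by rewrite -[x](scalerK two0) memvZ // -lH -hx mem_lie_span.
by rewrite -[y](scalerK two0) memvZ // -[2]opprK -lH -dualN scaleNr -hy memvN mem_lie_span.
Qed.

Lemma pos_root_add l m x y : root_space l x -> root_space m y ->
    (root_space l `<=` [set` b])%classic -> (root_space m `<=` [set` b])%classic ->
    lie x y != 0 -> l + m != 0 ->
  is_pos_root b (l + m).
Proof.
move=> hx hy lb mb xy lm; apply: (pos_root_mem lm (lie_root_space hx hy)) => //.
by have [bb _ _] := b_borel; apply: bb; [exact: lb|exact: mb].
Qed.

(** In a vanishing sum starting with [l], some term [m] makes an obtuse angle with
    [l]; then [l + m] is again a positive root, and the sum can be shortened. *)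
Lemma pos_root_no_zero_sum : ~ psum (is_pos_root (h := h) b) 0.
Proof.
move=> /psumP[s [Ps s0 E]].
have [n] := ubnP (size s); elim: n => // n IH in s Ps s0 E *.
case: s => [//|l s] in Ps s0 E *; rewrite /= ltnS => sn.
have pl : is_pos_root b l by apply: Ps; rewrite mem_head.
have [/is_rootP[l0 [x hx x0]] lb] := pl.
have [y [H xyH]] := sl2_triple_exists g_simple h_cartan e_basis e_weight l0 hx x0.
have [_ hy xy lH] := xyH.
have Ps' m : m \in s -> is_pos_root b m by move=> ms; apply: Ps; rewrite in_cons ms orbT.
(* [l] takes the value 2 on its coroot [H], and the values on [H] of the whole
   family are integers of sum 0. *)
have /hasP[m ms mH] : has (fun m : dual h => (m H : K) < 0) s.
  apply: contraT => /hasPn sH.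
  have [] : ~ ((2 : K) + \sum_(m <- s) (m H : K) = 0).
    apply/eqP; rewrite gt_eqF // ltr_pwDl ?ltr0n //.
    rewrite big_seq sumr_ge0 // => m ms.
    have [/is_rootP[_ [u hu u0]] _] := Ps' m ms.
    have [z mH] := sl2_int e_basis e_weight xyH hu u0.
    by have := sH m ms; rewrite mH ltrz0 ler0z leNgt.
  rewrite -lH; transitivity ((l + \sum_(m <- s) m) H : K).
    by rewrite dualD sum_lfunE.
  by move: E; rewrite big_cons => <-; rewrite dual0.
have pm := Ps' m ms; have [/is_rootP[m0 [u hu u0]] mb] := pm.
apply: (IH (l + m :: rem m s)) => //.
- move=> t; rewrite in_cons => /orP[/eqP ->|/mem_rem]; last exact: Ps'.
  apply: (pos_root_add hx hu) => //; first exact: (sl2_raise e_basis e_weight xyH hu u0).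
  apply/eqP => lm0; have ml : m = - l by apply/eqP; rewrite -addr_eq0 addrC lm0.
  by apply: (pos_root_opp pl); rewrite -ml.
- by rewrite [LHS]E !big_cons (perm_big _ (perm_to_rem ms)) /= big_cons addrA.
by rewrite /= size_rem //; case: (s) ms sn.
Qed.

End Borel.

(** * Borel subalgebras define positive systems *)

Section PositiveSystem.
Context {K : numFieldType} {g : lieAlgType K} {b h : {vspace g}}.
Variables (e : (\dim {:g}).-tuple g) (lam : 'I_(\dim {:g}) -> dual h).
Hypotheses (g_simple : simple_lie g) (h_cartan : is_cartan h).
Hypotheses (e_basis : basis_of {:g} e).
Hypotheses (e_weight : forall i, root_space (lam i) e`_i).
Hypotheses (b_borel : is_borel b) (h_sub_b : (h <= b)%VS).
Implicit Types (l m : dual h) (H : subvs_of h) (x y v u : g).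

(** A subspace stable under [h] contains the weight components of its elements. *)
Lemma weight_component_mem (U : {vspace g}) x l :
    (forall H u, u \in U -> lie (vsval H) u \in U) -> x \in U ->
  exists2 u, u \in U &
    forall i, coord e i u = if lam i == l then coord e i x else 0.
Proof.
move=> hU xU.
suff [u uU uE] : exists2 u, u \in U & forall i,
    (lam i = l -> coord e i u = coord e i x) /\
    (lam i != l -> lam i \in codom lam -> coord e i u = 0).
  exists u => // i; have [Ei Ni] := uE i.
  by have [/Ei //|/Ni->//] := eqVneq; apply: codom_f.
(* The components of the weights [m <> l] are removed one at a time by the
   operators [(ad H - m H) / (l H - m H)], for an [H] with [l H <> m H]. *)
elim: (codom lam) => [|m s [u uU uE]]; first by exists x.
have [ml|ml] := eqVneq m l.
  exists u => // i; have [Ei Ni] := uE i; split=> // lil.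
  by rewrite in_cons ml (negPf lil) => /Ni ->.
have [H lm] := dual_neq ml; rewrite eq_sym -subr_eq0 in lm.
exists ((l H - m H)^-1 *: (lie (vsval H) u - m H *: u)).
  by rewrite memvZ // memvB // ?memvZ // hU.
move=> i; have [Ei Ni] := uE i.
have cE : coord e i ((l H - m H)^-1 *: (lie (vsval H) u - m H *: u)) =
    (l H - m H)^-1 * ((lam i H - m H) * coord e i u).
  by rewrite linearZ linearB linearZ /= (coord_lie_cartan e_basis e_weight) -mulrBl.
rewrite cE; split=> [lil|lil].
  by rewrite -(Ei lil) lil mulKf.
rewrite in_cons => /orP[/eqP->|lis]; first by rewrite subrr mul0r mulr0.
by rewrite Ni // !mulr0.
Qed.

Lemma borel_coord x i :
  x \in b -> coord e i x != 0 -> lam i != 0 -> is_pos_root b (lam i).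
Proof.
move=> xb xi li.
have hb H u : u \in b -> lie (vsval H) u \in b.
  by have [bb _ _] := b_borel; apply: bb; apply: (subvP h_sub_b); apply: subvsP.
have [u ub uE] := weight_component_mem (lam i) hb xb.
apply: (pos_root_mem g_simple h_cartan e_basis e_weight li) ub.
  by apply/(root_spaceP e_basis e_weight) => j /negPf ji; rewrite uE ji.
by apply: contraNneq xi => u0; have := uE i; rewrite u0 linear0 eqxx => <-.
Qed.

(** The number of weights that are sums of elements of [P] and lie strictly below
    [v] in the order generated by [P]; it grows with [v] as soon as [P] has no
    zero sum, and stands in for a height function. *)
Definition psum_rank (P : dual h -> Prop) (v : dual h) :=
  #|[set i | `[< psum P (lam i) >] && `[< psum P (v - lam i) >]]|.

Lemma psum_rank_addr (P : dual h -> Prop) i (v : dual h) :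
    ~ psum P 0 -> psum P (lam i) -> psum P v ->
  (psum_rank P (lam i) < psum_rank P (lam i + v)%R)%N.
Proof.
move=> P0 Pi Pv; apply: proper_card; apply/properP; split.
  apply/fintype.subsetP => k; rewrite !inE => /andP[-> /asboolP ik] /=.
  by apply/asboolP; rewrite addrAC; apply: psumD.
exists i; rewrite inE; first by apply/andP; split; apply/asboolP; rewrite ?[_ + v]addrC ?addrK.
by rewrite subrr negb_and; apply/orP; right; apply/asboolP.
Qed.

Section Extension.
Variable P : dual h -> Prop.
Hypothesis P0 : ~ psum P 0.

(* [B] is spanned by [h] and the root vectors whose weights are sums of elements
   of [P]; [W k] will contain its derived algebra of order [k + 1]. *)
Let T i := `[< psum P (lam i) >].
Let W k := wspace e (fun i => T i && (k <= psum_rank P (lam i))%N).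
Let B := wspace e (fun i => (lam i == 0) || T i).

Lemma extension_lie_rank k x y : x \in W k -> y \in W k -> lie x y \in W k.+1.
Proof.
apply: wspace_lie => i j /andP[Ti ki] /andP[Tj kj].
apply: (root_space_wspace e_basis e_weight (lie_root_space (e_weight i) (e_weight j))) => t tE.
have {}Ti : psum P (lam i) by apply/asboolP.
have {}Tj : psum P (lam j) by apply/asboolP.
rewrite tE (leq_ltn_trans ki) ?psum_rank_addr // andbT.
by apply/asboolP; rewrite tE; apply: psumD.
Qed.

Lemma extension_lie x y : x \in B -> y \in B -> lie x y \in W 0.
Proof.
apply: wspace_lie => i j.
have inh k : lam k = 0 -> e`_k \in h.
  by move=> k0; apply/(root_space0 h_cartan); rewrite -k0; apply: e_weight.
have [h_ab _ _] := h_cartan.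
case/orP=> [/eqP i0|Ti] /orP[/eqP j0|Tj]; first by rewrite h_ab ?inh // mem0v.
all: apply: (root_space_wspace e_basis e_weight (lie_root_space (e_weight i) (e_weight j))) => t tE.
all: rewrite leq0n andbT; apply/asboolP; rewrite tE ?i0 ?j0 ?add0r ?addr0.
- exact/asboolP.
- exact/asboolP.
by apply: psumD; apply/asboolP.
Qed.

Lemma extension_sub k : (W k <= B)%VS.
Proof.
apply/subvP => x /(mem_wspace e_basis) hx; apply/(mem_wspace e_basis) => i.
by rewrite negb_or => /andP[_ /negPf Ti]; apply: hx; rewrite Ti.
Qed.

(** Brackets of elements of [B] are sums of root vectors, and every further bracket
    raises [psum_rank]. *)
Lemma extension_solvable : solvable_lie B.
Proof.
have iterW k : (iter k.+1 (fun U => lie_span U U) B <= W k)%VS.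
  elim: k => [|k IH]; first by apply: lie_span_sub; apply: extension_lie.
  rewrite iterS; apply: lie_span_sub => x y xU yU.
  by apply: extension_lie_rank; apply: (subvP IH).
(* The rank is at most the number [dim g] of weights. *)
exists (\dim {:g}).+2; apply/eqP; rewrite -subv0; apply: subv_trans (iterW _) _.
apply/subvP => x /(mem_wspace e_basis) hx; rewrite memv0; apply/eqP.
apply: (coord_ext e_basis) => i; rewrite linear0; apply: hx.
by rewrite negb_and -ltnNge ltnS -[X in (_ <= X)%N]card_ord max_card orbT.
Qed.

(** A set without vanishing sums that contains the positive roots contains no
    other root: [B] is a solvable subalgebra containing [b], hence equal to [b]. *)
Lemma borel_extension :
    (forall l, is_pos_root b l -> P l) ->
  forall l, is_root l -> P l -> is_pos_root b l.
Proof.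
move=> SP.
have bB : (b <= B)%VS.
  apply/subvP => x xb; apply/(mem_wspace e_basis) => i.
  rewrite negb_or => /andP[li Ti]; apply: contraNeq Ti => xi.
  by apply/asboolP/psum1/SP; apply: (borel_coord xb xi li).
have subB : is_subalgebra B.
  by move=> x y xB yB; apply: (subvP (extension_sub 0)); apply: extension_lie.
have [_ _ /(_ _ subB extension_solvable bB) BE] := b_borel.
move=> l rl Pl; split=> // x hx /=; rewrite -BE.
apply: (root_space_wspace e_basis e_weight hx) => i li.
by apply/orP; right; apply/asboolP; rewrite li; apply: psum1.
Qed.

End Extension.

(** The roots of a Borel subalgebra form a positive system. If neither [l] nor
    [- l] were positive, [psum_extend] would produce a solvable subalgebra strictly
    larger than [b]. *)
Lemma pos_or_neg l : is_root l -> is_pos_root b l \/ is_pos_root b (- l).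
Proof.
move=> rl; have rNl := is_root_opp g_simple h_cartan e_basis e_weight rl.
have S0 := @pos_root_no_zero_sum _ _ b h e lam g_simple h_cartan e_basis e_weight b_borel h_sub_b.
have l0 k : l *+ k.+1 != 0.
  have [/eqP l0 _] := rl; apply/eqP => lk; have := dualMn_inj l0 (lk : _ = l *+ 0).
  by [].
have [P0|P0] := psum_extend S0 l0; [left|right].
  by apply: (borel_extension P0) => //; [left|right].
by apply: (borel_extension P0) => //; [left|right].
Qed.

End PositiveSystem.

(** * Simple roots *)

Section SimpleRoots.
Context {K : numFieldType} {g : lieAlgType K} {b h : {vspace g}}.
Variables (e : (\dim {:g}).-tuple g) (lam : 'I_(\dim {:g}) -> dual h).
Hypotheses (g_simple : simple_lie g) (h_cartan : is_cartan h).
Hypotheses (e_basis : basis_of {:g} e).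
Hypotheses (e_weight : forall i, root_space (lam i) e`_i).
Hypotheses (b_borel : is_borel b) (h_sub_b : (h <= b)%VS).
Implicit Types (l m : dual h) (H : subvs_of h) (x y v u : g).

Let S0 : ~ psum (is_pos_root (h := h) b) 0.
Proof. exact: (pos_root_no_zero_sum g_simple h_cartan e_basis e_weight). Qed.

(** A positive root is a sum of simple roots, by induction on [psum_rank]. *)
Lemma pos_root_simple_sum l : is_pos_root b l -> psum (@is_simple_root _ _ b h) l.
Proof.
have [k] := ubnP (psum_rank lam (@is_pos_root _ _ b h) l); elim: k l => // k IH l lk pl.
have [sl|] := pselect (is_simple_root b l); first exact: psum1.
move=> nsl; have [m [m' [pm pm' lE]]] : exists m m' : dual h,
    [/\ is_pos_root b m, is_pos_root b m' & l = m + m'].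
  by apply: contrapT => no; apply: nsl.
have rk m1 m2 : is_pos_root b m1 -> is_pos_root b m2 -> l = m1 + m2 ->
    psum (@is_simple_root _ _ b h) m1.
  move=> pm1 pm2 lE'; apply: IH => //; rewrite -ltnS (leq_trans _ lk) // ltnS lE'.
  have [/is_rootP[_ [x hx x0]] _] := pm1.
  have [i li] := weight_exists e_basis e_weight hx x0.
  by rewrite -li; apply: psum_rank_addr; rewrite ?li //; apply: psum1.
by rewrite lE; apply: psumD; [apply: rk lE|apply: (rk _ m) => //; rewrite addrC].
Qed.

Section Enumeration.
Variables (n : nat) (alpha : 'I_n -> dual h).
Hypotheses (rank_g : \dim h = n) (alpha_simple : enumerates_simple_roots b alpha).

Lemma simple_root_alpha i : is_simple_root b (alpha i).
Proof.
have [_ E] := alpha_simple.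
have : range alpha (alpha i) by exists i.
by rewrite E.
Qed.

Lemma pos_root_coord l : is_pos_root b l ->
  exists2 c : 'I_n -> nat, (exists i, (0 < c i)%N) & l = \sum_i alpha i *+ c i.
Proof.
have [_ alphaE] := alpha_simple.
have simp m : is_simple_root b m -> exists i, m = alpha i.
  move=> sm; have : ([set m | is_simple_root b m])%classic m by [].
  by rewrite -alphaE => -[i _ <-]; exists i.
have one i : alpha i = \sum_j alpha j *+ (j == i).
  by rewrite (bigD1 i) //= eqxx big1 ?addr0 // => j /negPf ->.
move/pos_root_simple_sum; elim=> [u /simp[i ->]|u v /simp[i ->] _ [c _ ->]].
  by exists (fun j => (j == i : nat)) => //; exists i; rewrite eqxx.
exists (fun j => (j == i) + c j)%N; first by exists i; rewrite eqxx.
by rewrite {1}one -big_split; apply: eq_bigr => j _; rewrite mulrnDr.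
Qed.

Lemma simple_root_separate H : (forall i, alpha i H = 0 :> K) -> H = 0.
Proof.
move=> H0; apply: (central_cartan g_simple e_basis e_weight) => i.
have pos0 l : is_pos_root b l -> l H = 0 :> K.
  move=> /pos_root_coord[c _ ->]; rewrite sum_lfunE big1 // => j _.
  by rewrite dualMn H0 mul0rn.
have [->|li] := eqVneq (lam i) 0; first by rewrite dual0.
have /(pos_or_neg g_simple h_cartan e_basis e_weight b_borel h_sub_b) : is_root (lam i).
  by apply/is_rootP; split=> //; exists e`_i; rewrite ?(eigen_neq0 e_basis).
by case=> /pos0 //; rewrite dualN => /eqP; rewrite oppr_eq0 => /eqP.
Qed.

Lemma simple_root_dual_basis j : exists H, forall i, alpha i H = (i == j)%:R :> K.
Proof.
pose f (H : subvs_of h) : 'rV[K]_n := \row_i alpha i H.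
have fE : linfun f =1 f.
  by apply: linear_linfunE => c x y; apply/rowP => i; rewrite !mxE linearP.
have f0 : lker (linfun f) == 0%VS.
  rewrite -subv0; apply/subvP => H; rewrite memv_ker fE memv0 => /eqP/rowP fH.
  by apply/eqP/simple_root_separate => i; have := fH i; rewrite !mxE.
have fs : limg (linfun f) = fullv.
  apply/eqP; rewrite eqEdim subvf /= limg_dim_eq ?(eqP f0) ?capv0 //.
  by rewrite !dimvf /dim /= rank_g mul1n.
have /memv_imgP[H _ E] : delta_mx 0 j \in limg (linfun f) by rewrite fs memvf.
by exists H => i; move: E; rewrite fE => /rowP/(_ i); rewrite !mxE eqxx /= => <-.
Qed.

(** The simple roots separate the points of [h], and there are [dim h] of them; so
    they are linearly independent. *)
Lemma simple_root_free (c : 'I_n -> K) :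
  \sum_i c i *: alpha i = 0 -> forall i, c i = 0.
Proof.
move=> E j; have [H HE] := simple_root_dual_basis j.
move/(congr1 (fun l : dual h => l H : K)): E.
rewrite sum_lfunE (bigD1 j) //= big1 => [|i /negPf ij]; last first.
  by rewrite scale_lfunE HE ij scaler0.
by rewrite scale_lfunE HE eqxx addr0 dual0 -[_ *: _]/(_ * _) mulr1.
Qed.

End Enumeration.
End SimpleRoots.

(** * The form on the dual of the Cartan subalgebra *)

Section DualForm.
Context {K : numFieldType} {g : lieAlgType K} {h : {vspace g}}.
Variables (e : (\dim {:g}).-tuple g) (lam : 'I_(\dim {:g}) -> dual h).
Hypotheses (g_simple : simple_lie g) (h_cartan : is_cartan h).
Hypotheses (e_basis : basis_of {:g} e).
Hypotheses (e_weight : forall i, root_space (lam i) e`_i).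
Implicit Types (l m : dual h) (H : subvs_of h) (x y v u : g).

Lemma killing_mapE H H' : killing_map h H H' = killing (vsval H) (vsval H').
Proof.
have lin_r (u : subvs_of h) : linear (fun y : subvs_of h => killing (vsval u) (vsval y) : K^o).
  by move=> c x y; rewrite !linearP.
rewrite linear_linfunE; first by rewrite linear_linfunE //; apply: lin_r.
move=> c x y; apply/lfunP => z; rewrite add_lfunE scale_lfunE !linear_linfunE //;
  try exact: lin_r.
by rewrite linearP /= killingDl killingZl.
Qed.

Lemma dual_formC l m : dual_form l m = dual_form m l.
Proof. exact: killingC. Qed.

Lemma dual_form_linear_r l : linear (dual_form l : dual h -> K^o).
Proof. by move=> c m m'; rewrite /dual_form !linearP. Qed.

Lemma killing_map_inj : lker (killing_map h) == 0%VS.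
Proof.
rewrite -subv0; apply/subvP => H; rewrite memv_ker memv0 => /eqP kH; apply/eqP.
apply: (killing_cartan_nondeg g_simple h_cartan e_basis e_weight) => H'.
by rewrite -killing_mapE kH dual0.
Qed.

(** The form on the dual of [h] expressed by coroots: [(m, l) = 2 m(H) / n], where
    [H] is the coroot of [l] and [n = (H, H)] is a positive integer. *)
Lemma dual_form_root l : is_root l -> exists x y H (n : nat),
  [/\ sl2_triple l x y H, x != 0, (0 < n)%N &
      forall m, is_root m -> dual_form m l = m H * (2 / n%:R)].
Proof.
have coroot m : is_root m -> exists x y H (n : nat),
    [/\ sl2_triple m x y H, x != 0, (0 < n)%N & m = (2 / n%:R) *: killing_map h H].
  case/is_rootP => m0 [x hx x0].
  have [y [H xyH]] := sl2_triple_exists g_simple h_cartan e_basis e_weight m0 hx x0.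
  have [_ hy xy mH] := xyH; have mH0 : m H != 0 :> K by rewrite mH pnatr_eq0.
  have [n n0 nE] := killing_bracket_gt0 e_basis e_weight m0 hx hy xy mH0 x0.
  exists x, y, H, n; split=> //; apply/lfunP => H'.
  have nK : n%:R != 0 :> K by rewrite pnatr_eq0 -lt0n.
  have four0 : 4 != 0 :> K by rewrite pnatr_eq0.
  have kH : killing (vsval H) (vsval H) = n%:R.
    by apply: (mulfI four0); rewrite nE mH mulrC expr2 -natrM.
  have kxy : 2 * killing x y = n%:R by rewrite -mH -(killing_lie_cartan _ hx hy) xy.
  rewrite scale_lfunE killing_mapE -xy (killing_lie_cartan _ hx hy) -kxy.
  have k0 : killing x y != 0 by apply: contraNneq nK => k0; rewrite -kxy k0 mulr0.
  rewrite -[_ *: _]/(_ * _) invfM mulrA divff ?pnatr_eq0 // mul1r.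
  by rewrite mulrCA mulVf // mulr1.
case/coroot => x [y [H [n [xyH x0 n0 lE]]]]; exists x, y, H, n; split=> // m.
case/coroot => _ [_ [H' [n' [_ _ _ mE]]]].
have tl : (killing_map h)^-1%VF l = (2 / n%:R) *: H.
  by rewrite lE linearZ /= lker0_lfunK ?killing_map_inj.
have tm : (killing_map h)^-1%VF m = (2 / n'%:R) *: H'.
  by rewrite mE linearZ /= lker0_lfunK ?killing_map_inj.
rewrite /dual_form tl tm {1}mE scale_lfunE killing_mapE /= linearZ /= killingZl.
by rewrite [LHS]mulrC.
Qed.

End DualForm.

(** * Roots with real coordinates *)

Section RealRoots.
Context {R : realType} {g : lieAlgType R[i]} {b h : {vspace g}}.
Context {n : nat} (alpha : 'I_n -> dual h).
Hypotheses (g_simple : simple_lie g) (b_borel : is_borel b).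
Hypotheses (h_cartan : is_cartan h) (h_sub_b : (h <= b)%VS).
Hypotheses (rank_g : \dim h = n) (alpha_simple : enumerates_simple_roots b alpha).
Implicit Types (u v w : 'rV[R]_n).

Lemma V_dual_linear (c : R) u v :
  V_dual alpha (c *: u + v) = c%:C%C *: V_dual alpha u + V_dual alpha v.
Proof.
rewrite /V_dual scaler_sumr -big_split; apply: eq_bigr => i _ /=.
by rewrite !mxE rmorphD rmorphM scalerDl scalerA.
Qed.

Lemma V_dualD u v : V_dual alpha (u + v) = V_dual alpha u + V_dual alpha v.
Proof. by have := V_dual_linear 1 u v; rewrite rmorph1 !scale1r. Qed.

Lemma V_dual0 : V_dual alpha 0 = 0.
Proof. by apply: (addIr (V_dual alpha 0)); rewrite -V_dualD !add0r. Qed.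

Lemma V_dualN v : V_dual alpha (- v) = - V_dual alpha v.
Proof. by apply/eqP; rewrite -addr_eq0 -V_dualD addNr V_dual0. Qed.

Lemma V_dualMz v (z : int) : V_dual alpha (v *~ z) = V_dual alpha v *~ z.
Proof.
have M k : V_dual alpha (v *+ k) = V_dual alpha v *+ k.
  by elim: k => [|k IH]; rewrite ?V_dual0 // !mulrS V_dualD IH.
by case: z => k; rewrite ?NegzE ?mulrNz ?V_dualN -!pmulrn M.
Qed.

Lemma V_dual_inj : injective (V_dual alpha).
Proof.
move=> u v uv; apply/eqP; rewrite -subr_eq0; apply/eqP/rowP => i; rewrite [RHS]mxE.
have [e [lam [e_basis e_weight]]] := weight_basis_exists h_cartan.
have := simple_root_free g_simple h_cartan e_basis e_weight b_borel h_sub_b rank_g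
  alpha_simple (c := fun j => ((u - v) 0 j)%:C%C).
move=> /(_ _ i)/(congr1 (@complex.Re R)) /= -> //.
by have : V_dual alpha (u - v) = 0; [rewrite V_dualD V_dualN uv subrr|].
Qed.

Lemma V_dual_delta i : V_dual alpha (delta_mx 0 i) = alpha i.
Proof.
rewrite /V_dual (bigD1 i) //= big1 => [|j /negPf ji]; rewrite mxE eqxx /=.
  by rewrite eqxx rmorph1 scale1r addr0.
by rewrite ji rmorph0 scale0r.
Qed.

Lemma V_formC u v : V_form alpha u v = V_form alpha v u.
Proof. by rewrite /V_form dual_formC. Qed.

Lemma V_form_linear u : linear (V_form alpha u : 'rV[R]_n -> R^o).
Proof.
move=> c v w; rewrite /V_form V_dual_linear.
have -> := dual_form_linear_r (V_dual alpha u) c%:C%C (V_dual alpha v) (V_dual alpha w).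
rewrite -[_ *: _]/(_ * _) -[c *: _]/(_ * _).
case: (dual_form _ _) => x y; case: (dual_form _ _) => x' y' /=.
by rewrite mul0r subr0.
Qed.

HB.instance Definition _ u :=
  GRing.isLinear.Build R 'rV[R]_n R^o *:%R (V_form alpha u : _ -> R^o) (V_form_linear u).

Lemma Delta_opp v : Delta alpha v -> Delta alpha (- v).
Proof.
have [e [lam [e_basis e_weight]]] := weight_basis_exists h_cartan.
by rewrite /Delta /= V_dualN; apply: (is_root_opp g_simple h_cartan e_basis e_weight).
Qed.

Lemma Delta_neq0 v : Delta alpha v -> v <> 0.
Proof. by move=> [v0 _] vE; apply: v0; rewrite vE V_dual0. Qed.

Lemma Delta_pos_Delta v : Delta_pos b alpha v -> Delta alpha v.
Proof. by case. Qed.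

Lemma Delta_pos_or_neg v :
  Delta alpha v -> Delta_pos b alpha v \/ Delta_pos b alpha (- v).
Proof.
have [e [lam [e_basis e_weight]]] := weight_basis_exists h_cartan.
rewrite /Delta /Delta_pos /= V_dualN.
exact: (pos_or_neg g_simple h_cartan e_basis e_weight).
Qed.

Lemma Delta_pos_opp v : Delta_pos b alpha v -> ~ Delta_pos b alpha (- v).
Proof.
have [e [lam [e_basis e_weight]]] := weight_basis_exists h_cartan.
rewrite /Delta_pos /= V_dualN.
exact: (pos_root_opp g_simple h_cartan e_basis e_weight).
Qed.

(** The axioms of a root system for the roots with real coordinates: positivity,
    integrality, stability under reflections; the integer [z] is
    [2 (u, v) / (u, u)]. *)
Lemma root_cartan_integer u v : Delta alpha u -> Delta alpha v ->
  exists z : int, [/\ 2 * V_form alpha u v = z%:~R * V_form alpha u u,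
    0 < V_form alpha u u, Delta alpha (v - u *~ z) & 0 < z -> u <> v -> Delta alpha (v - u)].
Proof.
have [e [lam [e_basis e_weight]]] := weight_basis_exists h_cartan.
move=> ru rv; have [x [y [H [k [xyH x0 k0 uE]]]]] :=
  dual_form_root g_simple h_cartan e_basis e_weight ru.
have [hx hy xy uH] := xyH.
have [/is_rootP[v0 [t ht t0]]] := (conj rv I).
have [z vH] := sl2_int e_basis e_weight xyH ht t0.
have form w (s : int) : Delta alpha w -> V_dual alpha w H = s%:~R :> R[i] ->
    V_form alpha u w = s%:~R * (2 / k%:R).
  move=> rw wH; rewrite V_formC /V_form uE // wH.
  have -> : s%:~R * (2 / k%:R) = (s%:~R * (2 / k%:R))%:C%C :> R[i].
    by rewrite rmorphM rmorph_int fmorph_div !rmorph_nat.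
  by [].
exists z; split.
- by rewrite (form _ _ rv vH) (form _ 2%:Z ru uH) mulrCA.
- by rewrite (form _ 2%:Z ru uH) mulr_gt0 ?divr_gt0 ?ltr0n.
- have [s s0 hs] := sl2_reflect e_basis e_weight xyH ht t0 vH.
  apply/is_rootP; split; last by exists s => //; rewrite V_dualD V_dualN V_dualMz.
  rewrite V_dualD V_dualN V_dualMz; apply: contraNneq v0 => E.
  have := congr1 (fun l : dual h => l H : R[i]) E.
  rewrite dualD dualN dual0 dualMz vH uH -[2 *~ z]mulrzl mulr_natr mulr2n.
  rewrite opprD addrA subrr add0r.
  move/eqP; rewrite oppr_eq0 intr_eq0 => /eqP z0; move: E.
  by rewrite z0 mulr0z subr0 => ->.
(* For positive [z], lowering a root vector of [v] by the triple of [u] gives a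
   nonzero vector of weight [v - u]. *)
move=> z0 uv; have v'0 : lie y t != 0.
  by apply: (sl2_lower e_basis e_weight xyH ht t0); rewrite vH ltr0z.
have ht' := lie_root_space hy ht.
apply/is_rootP; rewrite V_dualD V_dualN addrC; split; last by exists (lie y t).
by rewrite addrC subr_eq0; apply/eqP => /V_dual_inj /esym.
Qed.

Lemma Delta_acute u v : Delta alpha u -> Delta alpha v -> 0 < V_form alpha u v ->
  u <> v -> Delta alpha (u - v).
Proof.
move=> ru rv uv neq; rewrite -opprB; apply: Delta_opp.
have [z [zE u0 _]] := root_cartan_integer ru rv; apply=> //.
have : 0 < z%:~R * V_form alpha u u by rewrite -zE mulr_gt0.
by rewrite pmulr_lgt0 // ltr0z.
Qed.

(** The roots of an ideal form an up-set, because [[g_v, g_u] = g_(u + v)]. *)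
Lemma Phi_up (I : {vspace g}) u v : is_nilradical_ideal b I -> Phi b alpha I u ->
  Delta_pos b alpha v -> Delta alpha (u + v) -> Phi b alpha I (u + v).
Proof.
have [e [lam [e_basis e_weight]]] := weight_basis_exists h_cartan.
move=> [[_ I_ideal] _] [[/is_rootP[u0 [x hx x0]] ub] uI] [/is_rootP[v0 [y hy y0]] vb].
move=> ruv; have := ruv; rewrite /Delta /= V_dualD => /is_rootP[uv0 [t ht t0]].
rewrite addrC in ht.
have yx := lie_root_neq0 g_simple h_cartan e_basis e_weight v0 u0 hy y0 hx x0 ht t0.
have hyx := lie_root_space hy hx; rewrite addrC in hyx.
split; first by rewrite /Delta_pos /= V_dualD addrC;
  apply: (pos_root_add g_simple h_cartan e_basis e_weight b_borel hy hx) => //;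
  rewrite addrC.
move=> s /=; rewrite V_dualD => hs.
have [c ->] := root_space_dim1 g_simple h_cartan e_basis e_weight uv0 hyx yx hs.
by apply: memvZ; apply: I_ideal; [exact: vb|exact: uI].
Qed.

Lemma Delta_pos_coord v : Delta_pos b alpha v ->
  exists2 c : 'I_n -> nat, (exists i, (0 < c i)%N) & v = \row_i (c i)%:R.
Proof.
have [e [lam [e_basis e_weight]]] := weight_basis_exists h_cartan.
case/(pos_root_coord g_simple h_cartan e_basis e_weight b_borel h_sub_b alpha_simple) => c c0 cE.
exists c => //; apply: V_dual_inj; rewrite cE; apply: eq_bigr => i _.
by rewrite mxE rmorph_nat scaler_nat.
Qed.

Lemma Delta_pos_delta i : Delta_pos b alpha (delta_mx 0 i).
Proof. by rewrite /Delta_pos /= V_dual_delta; case: (simple_root_alpha alpha_simple i). Qed.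

End RealRoots.

(** * Combinatorics of roots and of the powers of an ideal *)

Section AffineCombinatorics.
Context {R : realType} {g : lieAlgType R[i]} {b h : {vspace g}}.
Context {n : nat} {alpha : 'I_n -> dual h} {theta : 'rV[R]_n} {I : {vspace g}}.
Hypotheses (g_simple : simple_lie g) (b_borel : is_borel b).
Hypotheses (h_cartan : is_cartan h) (h_sub_b : (h <= b)%VS).
Hypotheses (rank_g : \dim h = n) (alpha_simple : enumerates_simple_roots b alpha).
Hypotheses (theta_highest : is_highest_root b alpha theta).
Hypotheses (I_ideal : is_nilradical_ideal b I).
Implicit Types (u v w : 'rV[R]_n).

Local Notation D := (Delta alpha).
Local Notation P := (Delta_pos b alpha).
Local Notation Ph := (Phi b alpha I).
Local Notation Php := (Phi_pow b alpha I).
Local Notation F := (V_form alpha).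

Let Dopp v : D v -> D (- v). Proof. exact: Delta_opp. Qed.
Let PD v : P v -> D v. Proof. exact: Delta_pos_Delta. Qed.
Let Dcases v : D v -> P v \/ P (- v).
Proof. exact: Delta_pos_or_neg. Qed.
Let Fpos v : D v -> 0 < F v v.
Proof.
move=> rv; have [z [_ r _ _]] :=
  root_cartan_integer g_simple b_borel h_cartan h_sub_b rank_g alpha_simple rv rv.
exact: r.
Qed.

Lemma V_formDl u v w : F (u + v) w = F u w + F v w.
Proof. by rewrite ![F _ w]V_formC linearD. Qed.

Lemma Delta_acute0 u v : D u -> D v -> 0 < F u v -> u - v = 0 \/ D (u - v).
Proof.
move=> ru rv uv; have [->|/eqP neq] := eqVneq u v; first by left; rewrite subrr.
by right; apply: (Delta_acute g_simple b_borel h_cartan h_sub_b rank_g alpha_simple).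
Qed.

(** If three roots [u], [v], [w] are such that [u + v] and [u + v + w] are roots,
    then [w] can be absorbed by [u] or by [v]. *)
Lemma three_roots u v w : D u -> D v -> D w -> D (u + v) -> D (u + v + w) ->
  (u + w = 0 \/ D (u + w)) \/ (v + w = 0 \/ D (v + w)).
Proof.
move=> ru rv rw ruv ruvw.
have [p|p] := ltP 0 (F (u + v + w) u).
  by right; have := Delta_acute0 ruvw ru p; rewrite addrAC [u + v]addrC addrK.
have [q|q] := ltP 0 (F (u + v + w) v).
  by left; have := Delta_acute0 ruvw rv q; rewrite addrAC addrK.
have acute_opp t : D t -> F t w < 0 -> t + w = 0 \/ D (t + w).
  move=> rt tw; rewrite -[w]opprK; apply: Delta_acute0 => //; first exact: Dopp.
  by rewrite linearN oppr_gt0.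
have [r|r] := ltP (F u w) 0; first by left; apply: acute_opp.
have [s|s] := ltP (F v w) 0; first by right; apply: acute_opp.
(* The four signs contradict [(u + v, u + v) > 0]. *)
have := Fpos ruv; move: p q r s.
rewrite !V_formDl !linearD /= (V_formC _ w u) (V_formC _ w v).
by move=> *; exfalso; lra.
Qed.

(** If [u + v = u' + v'] is a root, then [u'] differs from [u] or from [v] by a root
    or by zero. *)
Lemma four_roots u v u' v' : D u -> D v -> D u' -> D v' -> D (u + v) ->
    u + v = u' + v' ->
  (u - u' = 0 \/ D (u - u')) \/ (v - u' = 0 \/ D (v - u')).
Proof.
move=> ru rv ru' rv' ruv E.
(* [(u + v, u' + v') > 0], so that one of the four products is positive. *)
have := Fpos ruv; rewrite {2}E V_formDl !linearD /=.
have opp t : t = 0 \/ D t -> - t = 0 \/ D (- t).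
  by case=> [->|/Dopp]; [left; rewrite oppr0|right].
have uv' : v - u' = - (u - v').
  by apply/eqP; rewrite opprB subr_eq addrAC eq_sym subr_eq eq_sym [v' + u']addrC -E addrC.
have vv' : u - u' = - (v - v').
  by apply/eqP; rewrite opprB subr_eq addrAC eq_sym subr_eq eq_sym [v' + u']addrC -E.
have [p _|p] := ltP 0 (F u u'); first by left; apply: Delta_acute0.
have [q _|q] := ltP 0 (F v u'); first by right; apply: Delta_acute0.
have [r _|r] := ltP 0 (F u v'); first by right; rewrite uv'; apply/opp/Delta_acute0.
have [s _|s] := ltP 0 (F v v'); first by left; rewrite vv'; apply/opp/Delta_acute0.
by clear E uv' vv'; move=> ?; exfalso; lra.
Qed.

(** The sum of the coordinates in the simple roots. *)
Definition height v : R := \sum_i v 0 i.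

Lemma heightD u v : height (u + v) = height u + height v.
Proof. by rewrite /height -big_split; apply: eq_bigr => i _; rewrite mxE. Qed.

Lemma heightN v : height (- v) = - height v.
Proof. by rewrite /height -sumrN; apply: eq_bigr => i _; rewrite mxE. Qed.

Lemma Delta_pos_coord_ge0 v i : P v -> 0 <= v 0 i.
Proof.
case/(Delta_pos_coord g_simple b_borel h_cartan h_sub_b rank_g alpha_simple) => c _ ->.
by rewrite mxE ler0n.
Qed.

Lemma height_ge1 v : P v -> 1 <= height v.
Proof.
case/(Delta_pos_coord g_simple b_borel h_cartan h_sub_b rank_g alpha_simple) => c [i ci] ->.
rewrite /height (bigD1 i) //= mxE -[leLHS]addr0 lerD ?ler1n //.
by apply: sumr_ge0 => j _; rewrite mxE ler0n.
Qed.

Lemma Delta_pos_add u v : P u -> P v -> D (u + v) -> P (u + v).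
Proof.
move=> pu pv /Dcases[//|/height_ge1]; rewrite heightN heightD.
by have := height_ge1 pu; have := height_ge1 pv => *; exfalso; lra.
Qed.

Lemma D0_pos_add u v : P u -> P v -> u + v = 0 \/ D (u + v) -> D (u + v).
Proof.
move=> /height_ge1 pu /height_ge1 pv [] // uv0; exfalso.
have := heightD u v; rewrite uv0 /height big1 => [|i _]; last by rewrite mxE.
by rewrite -/(height u) -/(height v); lra.
Qed.

(** One step of [Phi_pow], which is indexed from 0: [Phi_pow I k] is the power of
    exponent [k + 1]. *)
Lemma Phi_powSP k v : Php k.+1 v ->
  D v /\ exists u u', [/\ Php k u, Ph u' & v = u + u'].
Proof. by []. Qed.

Lemma Phi_pow_pos k v : Php k v -> P v.
Proof.
elim: k v => [v []//|k IH v /= [rv [u [u' [/IH pu [pu' _] vE]]]]].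
by rewrite vE; apply: Delta_pos_add; rewrite -?vE.
Qed.

Lemma Phi_pow_up k u v : Php k u -> P v -> D (u + v) -> Php k (u + v).
Proof.
elim: k u => [|k IH] u; first exact: Phi_up.
move=> /= [ru [u1 [u2 [pu1 pu2 uE]]]] pv ruv; split=> //; rewrite uE in ru ruv *.
have p1 := Phi_pow_pos pu1; have p2 : P u2 by case: pu2.
have [/(D0_pos_add p1 pv) r|/(D0_pos_add p2 pv) r] :=
  three_roots (PD p1) (PD p2) (PD pv) ru ruv.
  by exists (u1 + v), u2; split=> //; [exact: IH|rewrite addrAC].
exists u1, (u2 + v); split=> //; last by rewrite addrA.
exact: Phi_up.
Qed.

Lemma Phi_pow_Phi k v : Php k v -> Ph v.
Proof.
elim: k v => // k IH v /= [rv [u [u' [/IH pu [pu' _] vE]]]].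
by rewrite vE; apply: Phi_up; rewrite -?vE.
Qed.

(** A minimal root of [Phi] is not the sum of an element of [Phi] and a positive
    root. *)
Lemma min_roots_indecomposable beta u v :
  min_roots b alpha I beta -> Ph u -> P v -> beta = u + v -> False.
Proof.
move=> [_ bmin] pu pv bE.
have ub : u = beta.
  apply: bmin => //; exists [:: v]; first by move=> x; rewrite inE => /eqP->.
  by rewrite big_seq1 bE addrC addKr.
apply: (Delta_neq0 (PD pv)); apply: (addrI u).
by rewrite addr0 -bE ub.
Qed.

(** The key step: a minimal root can be removed from an element of a power of
    [Phi], at the cost of lowering the exponent by one. *)
Lemma Phi_pow_sub_min beta k v : min_roots b alpha I beta -> P v ->
  Php k.+1 (beta + v) -> Php k v.
Proof.
move=> bmin; have pb : Ph beta by case: bmin.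
have rb : D beta by apply: PD; case: pb.
elim: k v => [|k IH] v pv /Phi_powSP[rbv [u1 [u2 [pu1 pu2 E]]]].
all: have p1 : P u1 by first [exact: (Phi_pow_pos pu1)|case: pu1].
all: have p2 : P u2 by case: pu2.
all: have := rbv; rewrite E => r12.
all: have vE : v = u1 + (u2 - beta) by rewrite addrA -E addrC addKr.
all: have vE' : v = u2 + (u1 - beta) by rewrite addrA [u2 + _]addrC -E addrC addKr.
all: have [] := four_roots (PD p1) (PD p2) rb (PD pv) r12 (esym E).
- case=> [nu0|/Dcases[nu|nu]]; first by rewrite vE' nu0 addr0.
    by rewrite vE'; apply: Phi_up => //; rewrite -vE'; apply: PD.
  by case: (min_roots_indecomposable bmin pu1 nu); rewrite opprB addrC subrK.
- case=> [nu0|/Dcases[nu|nu]]; first by rewrite vE nu0 addr0.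
    by rewrite vE; apply: Phi_up => //; rewrite -vE; apply: PD.
  by case: (min_roots_indecomposable bmin pu2 nu); rewrite opprB addrC subrK.
- case=> [/eqP|/Dcases[nu|nu]].
  + rewrite subr_eq0 => /eqP u1b; move: pu1; rewrite u1b => -[_ [s [t [ps [pt _] bE]]]].
    by case: (min_roots_indecomposable bmin (Phi_pow_Phi ps) pt bE).
  + have pnu : Php k (u1 - beta) by apply: IH => //; rewrite addrC subrK.
    split; first exact: PD.
    by exists (u1 - beta), u2; split=> //; rewrite addrC.
  by case: (min_roots_indecomposable bmin (Phi_pow_Phi pu1) nu); rewrite opprB addrC subrK.
case=> [nu0|/Dcases[nu|nu]]; first by rewrite vE nu0 addr0.
  by rewrite vE; apply: Phi_pow_up => //; rewrite -vE; apply: PD.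
by case: (min_roots_indecomposable bmin pu2 nu); rewrite opprB addrC subrK.
Qed.

(** * Affine roots and the affine Weyl group *)

Local Notation Dp := (Dhat_pos b alpha).
Local Notation L := (L_set b alpha I).
Implicit Types (x y : @Vhat R n).

(** The real affine roots: roots shifted by integral multiples of [delta]. *)
Definition Dhat : set (@Vhat R n) := [set x | D x.1 /\ exists z : int, x.2 = z%:~R].

Lemma Dhat_pos_Dhat x : Dp x -> Dhat x.
Proof.
case=> -[k [p kE]]; split.
- exact: PD.
- by exists k.
- by rewrite -[x.1]opprK; apply/Dopp/PD.
by exists k.+1.
Qed.

Lemma Dhat_pos_or_neg x : Dhat x -> Dp x \/ Dp (- x).
Proof.
move=> [/Dcases[p|p] [[k|k] xE]].
- by left; left; exists k.
- by right; right; exists k; rewrite /Delta_neg /= opprK xE NegzE mulrNz opprK.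
- case: k xE => [|k] xE; last by left; right; exists k.
  by right; left; exists 0%N; rewrite /= xE oppr0.
by right; left; exists k.+1; rewrite /= xE NegzE mulrNz opprK.
Qed.

Lemma root_le_height u v : root_le b alpha u v -> height u <= height v.
Proof.
case=> s sP /(congr1 height); rewrite heightD heightN => E.
rewrite -subr_ge0 E; elim: s sP {E} => [_|w s IH sP].
  by rewrite big_nil /height big1 // => i _; rewrite mxE.
rewrite big_cons heightD addr_ge0 //.
  by apply: (le_trans ler01); apply/height_ge1/sP; rewrite mem_head.
by apply: IH => t ts; apply: sP; rewrite in_cons ts orbT.
Qed.

Lemma theta_pos : P theta.
Proof.
have [rt tmax] := theta_highest.
have [//|/height_ge1] := Dcases rt; have := root_le_height (tmax _ (Dopp rt)).
by rewrite heightN => *; exfalso; lra.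
Qed.

(** The height of [v + c delta] in the affine simple roots. *)
Definition affine_height x : R := height x.1 + x.2 * (height theta + 1).

Lemma affine_heightD x y : affine_height (x + y) = affine_height x + affine_height y.
Proof. by rewrite /affine_height heightD mulrDl addrACA. Qed.

Lemma affine_heightN x : affine_height (- x) = - affine_height x.
Proof. by rewrite /affine_height heightN mulNr opprD. Qed.

Lemma height_theta_gt0 : 0 < height theta + 1.
Proof. by have := height_ge1 theta_pos; lra. Qed.

Lemma affine_height_ge1 x : Dp x -> 1 <= affine_height x.
Proof.
have t1 := height_ge1 theta_pos; rewrite /affine_height.
case=> -[k [p ->]].
  have := height_ge1 p; have : 0 <= k%:R * (height theta + 1) by rewrite mulr_ge0 ?ler0n //; lra.
  by move=> *; lra.
have [_ tmax] := theta_highest; have := root_le_height (tmax _ (PD p)).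
rewrite heightN -[k.+1]addn1 natrD mulrDl mul1r.
have : 0 <= k%:R * (height theta + 1) by rewrite mulr_ge0 ?ler0n //; lra.
by move=> *; lra.
Qed.

Lemma Dhat_pos_opp x : Dp x -> ~ Dp (- x).
Proof. by move=> /affine_height_ge1 ? /affine_height_ge1; rewrite affine_heightN; lra. Qed.

Lemma Dhat_pos_level x : Dp x -> 0 <= x.2.
Proof. by case=> -[k [_ ->]]; apply: ler0n. Qed.

Lemma affine_simple_pos i : Dp (affine_simple theta i).
Proof.
rewrite /affine_simple; case: unlift => [j|].
  by left; exists 0%N; split=> //; apply: (Delta_pos_delta alpha_simple).
by right; exists 0%N; split; rewrite // /Delta_neg /= opprK; apply: theta_pos.
Qed.

Lemma affine_height_simple i : affine_height (affine_simple theta i) = 1.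
Proof.
rewrite /affine_height /affine_simple; case: unlift => [j|] /=.
  rewrite mul0r addr0 /height (bigD1 j) //= mxE !eqxx big1 ?addr0 // => k /negPf kj.
  by rewrite mxE kj andbF.
by rewrite heightN mul1r addKr.
Qed.

(** The height of the left-hand side is 1, and that of the right-hand side at least
    2. *)
Lemma affine_simple_indecomposable i x y :
  Dp x -> Dp y -> affine_simple theta i <> x + y.
Proof.
move=> /affine_height_ge1 ? /affine_height_ge1 ? /(congr1 affine_height).
by rewrite affine_height_simple affine_heightD; lra.
Qed.

Lemma reflectionE x y :
  reflection alpha x y = y - (2 * Vhat_form alpha x y / Vhat_form alpha x x) *: x.
Proof.
apply: linear_linfunE => c u v; rewrite /Vhat_form linearP /= -[c *: (_ : R^o)]/(c * _).
set p := F _ _; set q := F _ _; set r := F _ _.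
have -> : 2 * (c * p + q) / r = c * (2 * p / r) + 2 * q / r by ring.
by rewrite scalerDl scalerBr [c *: (_ *: _)]scalerA opprD addrACA.
Qed.

Lemma Dhat_reflection x y : Dhat x -> Dhat y -> Dhat (reflection alpha x y).
Proof.
move=> [rx [c cE]] [ry [d dE]]; rewrite reflectionE.
have [z [zE x0 rz _]] :=
  root_cartan_integer g_simple b_borel h_cartan h_sub_b rank_g alpha_simple rx ry.
rewrite /Vhat_form zE mulfK ?gt_eqF //; split; first by rewrite /= scaler_int.
by exists (d - z * c); rewrite /= cE dE rmorphB rmorphM.
Qed.

Lemma reflectionK x : Dhat x -> involutive (reflection alpha x).
Proof.
move=> [/Fpos x0 _] y; rewrite !reflectionE.
set c := 2 * _ / _; set d := 2 * _ / _.
suff -> : d = - c by rewrite scaleNr opprK subrK.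
rewrite /d /c /Vhat_form /= linearB linearZ /= -[_ *: _]/(_ * _).
by field; rewrite gt_eqF.
Qed.

(** An injective endomorphism that permutes the real affine roots and fixes
    [delta]; every element of the affine Weyl group is one. *)
Definition affine_automorphism (w : 'End(@Vhat R n)) : Prop :=
  [/\ lker w == 0%VS, forall x, Dhat (w x) <-> Dhat x & forall c, w (0, c) = (0, c)].

Lemma affine_weyl_automorphism (w : 'End(@Vhat R n)) :
  affine_weyl alpha theta w -> affine_automorphism w.
Proof.
elim=> [|i|w1 w2 _ [/lker0P i1 d1 c1] _ [/lker0P i2 d2 c2]|w' _ [k d c]].
- split; [by apply/lker0P => x y; rewrite !id_lfunE|by move=> x; rewrite id_lfunE|].
  by move=> c; rewrite id_lfunE.
- have ri := Dhat_pos_Dhat (affine_simple_pos i); have rK := reflectionK ri.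
  split; first exact/lker0P/(inv_inj rK).
    by move=> x; split; [rewrite -{2}[x]rK|]; apply: Dhat_reflection.
  by move=> c; rewrite reflectionE /Vhat_form linear0 mulr0 mul0r scale0r subr0.
- split; first by apply/lker0P => x y; rewrite !comp_lfunE => /i1/i2.
    by move=> x; rewrite comp_lfunE; split=> [/d1/d2|/d2/d1].
  by move=> c; rewrite comp_lfunE c2 c1.
have K := lker0_lfunK k; have VK := lker0_lfunVK k.
split; first exact/lker0P/(can_inj VK).
  by move=> x; split=> [/d|rx]; [rewrite VK|apply/d; rewrite VK].
by move=> a; rewrite -{1}(c a) K.
Qed.

Section Inversions.
Variable w : 'End(@Vhat R n).
Hypotheses (w_weyl : affine_weyl alpha theta w).
Hypotheses (w_inversions : inversions b alpha w = L).

Let wK : cancel w w^-1%VF.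
Proof. by have [k _ _] := affine_weyl_automorphism w_weyl; apply: lker0_lfunK. Qed.
Let wVK : cancel w^-1%VF w.
Proof. by have [k _ _] := affine_weyl_automorphism w_weyl; apply: lker0_lfunVK. Qed.
Let w_Dhat x : Dhat (w x) <-> Dhat x.
Proof. by have [_ d _] := affine_weyl_automorphism w_weyl. Qed.
Let w_delta c : w (0, c) = (0, c).
Proof. by have [_ _ d] := affine_weyl_automorphism w_weyl. Qed.

Lemma mem_L x : L x <-> Dp x /\ Dp (- (w^-1)%VF x).
Proof. by rewrite -w_inversions. Qed.

Lemma L_level x : L x -> 1 <= x.2.
Proof. by case=> k _ ->; rewrite ler1n. Qed.

Lemma Phi_L u : Ph u -> L (- u, 1).
Proof. by move=> pu; exists 0%N => //=; rewrite opprK. Qed.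

(** The affine positive roots that [w] makes negative are read off [L]. *)
Lemma neg_image_L x : Dp x -> ~ Dp (w x) -> L (- w x).
Proof.
move=> px npx; apply/mem_L; split; last by rewrite [(w^-1)%VF _]linearN /= opprK wK.
have /Dhat_pos_or_neg[] // : Dhat (w x) by apply/w_Dhat/Dhat_pos_Dhat.
Qed.

(** No element of [L] has level 0, so [w^-1] keeps the finite positive roots
    positive. *)
Lemma finite_root_pos u : P u -> Dp ((w^-1)%VF (u, 0)).
Proof.
move=> pu; have du : Dp (u, 0) by left; exists 0%N.
have /Dhat_pos_or_neg[//|neg] : Dhat ((w^-1)%VF (u, 0)).
  by apply/w_Dhat; rewrite wVK; apply: Dhat_pos_Dhat.
have /L_level : L (u, 0) by apply/mem_L.
by rewrite /= ler10.
Qed.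

Lemma simple_to_min i beta : P beta -> w (affine_simple theta i) = (beta, -1) ->
  min_roots b alpha I beta.
Proof.
move=> pb wi.
have xE : (w^-1)%VF (- beta, 1) = - affine_simple theta i.
  by rewrite -[affine_simple _ _]wK wi -linearN; congr (_ _); rewrite /= -[RHS]/(_, _) opprK.
have : L (- beta, 1).
  apply/mem_L; split; last by rewrite xE opprK; apply: affine_simple_pos.
  by right; exists 0%N; rewrite /Delta_neg /= opprK.
case=> k /= pk kE; have /eqP[k0] : (1 == k.+1)%N by rewrite -(eqr_nat R) -kE eqxx.
rewrite -k0 /= opprK in pk; split=> // u pu [s sP E].
(* [alpha_i] is the sum of the positive roots [- w^-1 (- u + delta)] and
   [w^-1 v], for [v] in [s]; its height being 1, [s] is empty. *)
have : affine_height ((w^-1)%VF (\sum_(v <- s) v, 0)) >= (size s)%:R.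
  elim: s sP {E} => [_|v s IH sP].
    by rewrite big_nil -(w_delta 0) wK /affine_height /= mul0r addr0 /height big1 //
      => i' _; rewrite mxE.
  rewrite big_cons (_ : (v + _, 0) = (v, 0) + (\sum_(v <- s) v, 0) :> Vhat); last first.
    by congr pair; rewrite addr0.
  rewrite linearD affine_heightD /= -add1n natrD lerD //.
    by apply/affine_height_ge1/finite_root_pos/sP; rewrite mem_head.
  by apply: IH => t ts; apply: sP; rewrite in_cons ts orbT.
rewrite -E.
have -> : (beta - u, 0) = (- u, 1) - (- beta, 1) :> @Vhat R n.
  by congr pair; rewrite /= ?opprK ?subrr // addrC.
rewrite linearB /= xE opprK affine_heightD affine_height_simple.
have [_ /affine_height_ge1] := (mem_L _).1 (Phi_L pu).
rewrite affine_heightN => n1; case: s {sP} E => [E _|v s _ /= /(le_trans _)].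
  by apply/esym/eqP; rewrite -subr_eq0 E big_nil.
move=> /(_ 1); rewrite ler1n => /(_ isT) n2; have := lerD n1 n2.
by rewrite addrA addNr add0r -[leRHS]addr0 lerD2l ler10.
Qed.

(** An element of [L] of level at least 2 is a sum of two elements of [L], whereas
    the affine simple roots are indecomposable. *)
Lemma simple_image_level i : -1 <= (w (affine_simple theta i)).2.
Proof.
have [/Dhat_pos_level p|np] := pselect (Dp (w (affine_simple theta i))).
  by rewrite (le_trans _ p) // lerN10.
have := neg_image_L (affine_simple_pos i) np.
case=> -[|k] pk kE; first by rewrite -lerN2 opprK -[- _]/(- w _).2 kE.
have {pk} [_ [u [v [pu pv E]]]] := Phi_powSP pk; exfalso.
have /mem_L[_ pu'] : L (- u, k.+1%:R) by exists k => //=; rewrite opprK.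
have /mem_L[_ pv'] := Phi_L pv.
apply: (affine_simple_indecomposable (i := i) pu' pv').
rewrite -opprD -linearD -[LHS]wK -linearN; congr (_ _).
apply: oppr_inj; rewrite opprK [LHS]surjective_pairing kE -natr1.
by congr pair; rewrite -opprD -E opprK.
Qed.

(** For a minimal [beta], the affine positive root [w^-1 (beta - delta)] is not the
    sum of two affine positive roots. One of the two images has a negative level,
    say [- m], and is [phi - m delta] with [phi] in the power of exponent [m]; the
    other one is [(beta - phi) + (m - 1) delta]. If [beta - phi] is positive, then
    [beta] is not minimal. If [phi - beta] is positive, then the other image lies in
    [- L] when [m = 1], against the absence of level 0 in [L]; when [m > 1], it lies
    in [L] by [Phi_pow_sub_min], against the positivity of its preimage. *)
Lemma min_image_indecomposable beta x y : min_roots b alpha I beta ->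
  Dp x -> Dp y -> w x + w y = (beta, -1) -> False.
Proof.
move=> bmin.
wlog : x y / (w y).2 < 0 => [IH px py E|y0 px py E].
  have [y0|y0] := ltP (w y).2 0; first exact: (IH x y).
  apply: (IH y x) => //; last by rewrite addrC.
  by move: (congr1 snd E) y0 => /= {E IH}; lra.
have npy : ~ Dp (w y) by move=> /Dhat_pos_level; rewrite leNgt y0.
have [k pk kE] := neg_image_L py npy; rewrite opprK in pk.
have {}kE : (w y).2 = - k.+1%:R by rewrite -kE /= opprK.
have bE : beta = (w y).1 + (w x).1 by have := congr1 fst E; rewrite addrC.
have wx2 : (w x).2 = k%:R.
  move: (congr1 snd E); rewrite /= kE -natr1 => /eqP.
  by rewrite subr_eq addrCA addNr addr0 => /eqP.
have [rx _] : Dhat (w x) by apply/w_Dhat/Dhat_pos_Dhat.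
have [p|p] := Dcases rx.
  exact: (min_roots_indecomposable bmin (Phi_pow_Phi pk) p bE).
have npx : ~ L (w x).
  by move=> /mem_L[_]; rewrite wK; apply: Dhat_pos_opp.
apply: npx; case: k => [|k] in pk kE wx2 *.
  have /neg_image_L : ~ Dp (w x).
    case=> -[j [q jE]]; first exact: (Delta_pos_opp _ _ _ _ _ p).
    by move/eqP: jE; rewrite wx2 eqr_nat.
  by move=> /(_ px)/L_level; rewrite /= wx2 oppr0 ler10.
exists k => //; apply: (Phi_pow_sub_min bmin) => //.
by rewrite bE -addrA subrr addr0.
Qed.

(** An affine positive root is a combination of affine simple roots with
    nonnegative coefficients and has a positive square length. *)
Lemma simple_acute x : Dp x -> exists i, 0 < F x.1 (affine_simple theta i).1.
Proof.
move=> px; apply: contrapT => /forallNP no.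
have {}no i : F x.1 (affine_simple theta i).1 <= 0.
  by rewrite leNgt; apply/negP/no.
have x2 := Dhat_pos_level px.
have c0 j : 0 <= (x.1 + x.2 *: theta) 0 j.
  have t0 := Delta_pos_coord_ge0 j theta_pos.
  case: px => -[k [p xE]]; rewrite xE !mxE.
    by rewrite addr_ge0 ?mulr_ge0 ?ler0n // Delta_pos_coord_ge0.
  have [_ /(_ _ (PD p))[s sP /rowP/(_ j)]] := theta_highest.
  rewrite opprK mxE addrC -natr1 mulrDl mul1r addrCA => ->.
  rewrite addr_ge0 ?mulr_ge0 ?ler0n // summxE big_seq sumr_ge0 // => v vs.
  by apply: Delta_pos_coord_ge0; apply: sP.
have := Fpos (Dhat_pos_Dhat px).1.
have {2}-> : x.1 = x.2 *: (- theta) + \sum_j (x.1 + x.2 *: theta) 0 j *: delta_mx 0 j.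
  by rewrite -row_sum_delta scalerN addrC addrK.
rewrite linearD linearZ linear_sum /= ltNge => /negP[].
rewrite -[leRHS]addr0 lerD //.
  by have := no ord0; rewrite /affine_simple unlift_none => ?; apply: mulr_ge0_le0.
apply: sumr_le0 => j _; rewrite linearZ; apply: mulr_ge0_le0 => //.
by have := no (lift ord0 j); rewrite /affine_simple liftK.
Qed.

Lemma min_to_simple beta : min_roots b alpha I beta ->
  exists i, w (affine_simple theta i) = (beta, -1).
Proof.
move=> bmin; have [pb _] := bmin.
have /mem_L[_] := Phi_L pb; set x := - _ => px.
have wx : w x = (beta, -1) by rewrite /x linearN /= wVK; congr pair; rewrite opprK.
have [i xi] := simple_acute px; exists i.
have pi := affine_simple_pos i; set a := affine_simple theta i in xi pi *.
have [rx [c cE]] := Dhat_pos_Dhat px; have [ra [d dE]] := Dhat_pos_Dhat pi.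
have [xa|rxa] := Delta_acute0 rx ra xi; last first.
  have dxa : Dhat (x - a).
    by split=> //; exists (c - d); rewrite rmorphB /= -cE -dE.
  have [pxa|nxa] := Dhat_pos_or_neg dxa; exfalso.
    apply: (min_image_indecomposable bmin pi pxa).
    by rewrite -linearD addrC subrK.
  by apply: (affine_simple_indecomposable (i := i) px nxa); rewrite opprB addrC subrK.
(* Here [x] and the simple root [a] have the same finite part; they differ by a
   multiple of [delta], which [w] fixes and which [simple_image_level] bounds. *)
have xE : x = a + (0, (c - d)%:~R).
  apply: injective_projections.
    by change (x.1 = a.1 + 0); rewrite addr0; apply/eqP; rewrite -subr_eq0 xa.
  by change (x.2 = a.2 + (c - d)%:~R); rewrite rmorphB /= -cE -dE addrC subrK.
have aE : w a = (beta, -1 - (c - d)%:~R).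
  apply: (addIr (w (0, (c - d)%:~R))).
  have <- : w x = w a + w (0, (c - d)%:~R) by rewrite {1}xE linearD.
  rewrite wx w_delta.
  by congr pair; rewrite ?addr0 // subrK.
have : 0 <= c - d.
  have := affine_height_ge1 px; rewrite xE affine_heightD affine_height_simple.
  rewrite lerDl /affine_height /= [height 0]big1 ?add0r => [|j _]; last by rewrite mxE.
  by rewrite pmulr_lge0 ?ler0z // height_theta_gt0.
have := simple_image_level i; rewrite -/a aE /= lerDl oppr_ge0 lerz0 => c1 c2.
suff -> : c - d = 0 by rewrite subr0.
by apply/eqP; rewrite eq_le c1 c2.
Qed.

End Inversions.
End AffineCombinatorics.

Theorem proposition3p4 (R : realType) (g : lieAlgType R[i]) (b h : {vspace g})
    (n : nat) (alpha : 'I_n -> dual h) (theta : 'rV[R]_n)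
    (I : {vspace g}) (w : 'End(@Vhat R n)) (beta : 'rV[R]_n)
    (g_simple : simple_lie g)
    (b_borel : is_borel b)
    (h_cartan : is_cartan h)
    (h_sub_b : (h <= b)%VS)
    (rank_g : \dim h = n)
    (alpha_simple : enumerates_simple_roots b alpha)
    (theta_highest : is_highest_root b alpha theta)
    (I_ideal : is_nilradical_ideal b I)
    (w_weyl : affine_weyl alpha theta w)
    (w_inversions : inversions b alpha w = L_set b alpha I)
    (beta_pos : Delta_pos b alpha beta) :
  (exists i : 'I_n.+1, w (affine_simple theta i) = (beta, - 1)) <->
  min_roots b alpha I beta.
Proof.
split=> [[i wi]|bmin].
  exact: (simple_to_min g_simple b_borel h_cartan h_sub_b rank_g alpha_simple
    theta_highest w_weyl w_inversions beta_pos wi).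
exact: (min_to_simple g_simple b_borel h_cartan h_sub_b rank_g alpha_simple
  theta_highest I_ideal w_weyl w_inversions bmin).
Qed.
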